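(* Consider Solution II, i.e. $\hat i=\arg\max_{1\le i\le L_S}X_i$. Let $R_F,R_{s,N}>0$, $\gamma_{th}=2^{R_F}-1$, $\gamma_{s,N}=\frac{2^{R_{s,N}}-1}{\alpha_N}$, and, when $\gamma_{th}<\beta$, $\eta=\log_2\left(\frac{\alpha_F}{\alpha_F-\alpha_N\gamma_{th}}\right)$, with $R_{s,N}\neq\eta$ in that case. Then the secrecy outage probability $SOP_{N,II}$ of user $N$ (defined in the context, with transmitting antenna $\hat i$) is $$SOP_{N,II}=\begin{cases}1,&\gamma_{th}\ge\beta\\ \Lambda_{1,II}+\Lambda_{2,II}+\Lambda_{3,II},&\gamma_{th}<\beta,\end{cases}$$ where $$\Lambda_{1,II}=F_{Y_{\hat i},II}\left(\tfrac{A_{\gamma_{th}}}{\gamma_0}\right),$$ $$\Lambda_{2,II}=\begin{cases}0,&R_{s,N}<\eta\\ \left[F_{Y_{\hat i},II}\left(\tfrac{\gamma_{s,N}}{\gamma_0}\right)-F_{Y_{\hat i},II}\left(\tfrac{A_{\gamma_{th}}}{\gamma_0}\right)\right]F_{Z_{\hat i}}\left(\tfrac{A_{\gamma_{th}}}{\gamma_E}\right),&R_{s,N}>\eta,\end{cases}$$ $$\Lambda_{3,II}=B_{N,II}^{(1)}-\sum_{m=0}^{a_N-1}\sum_{n=0}^{m}\sum_{p=0}^{a_E+n-1}\Psi_{N,II}\left[\frac{A_{\gamma_{th}}B_{N,II}^{(2)}}{\gamma_E}\right]^{p}e^{-\frac{A_{\gamma_{th}}B_{N,II}^{(2)}}{\gamma_E}},$$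 with $$B_{N,II}^{(1)}=\left[1-F_{Y_{\hat i},II}\left(\tfrac{A_{\gamma_{th}}}{\gamma_0}\right)\right]\left[1-F_{Z_{\hat i}}\left(\tfrac{A_{\gamma_{th}}}{\gamma_E}\right)\right],\qquad B_{N,II}^{(2)}=\frac{m_E}{\lambda_{ES}}+\frac{m_N\gamma_E2^{R_{s,N}}}{\gamma_0\lambda_{NS}},$$ $$\Psi_{N,II}=\binom{m}{n}\frac{m_N^m\,m_E^{a_E}\,\Gamma(a_E+n)\,\gamma_{s,N}^{m-n}\left(2^{R_{s,N}}\gamma_E\right)^n e^{-\frac{m_N\gamma_{s,N}}{\gamma_0\lambda_{NS}}}}{m!\,p!\,\Gamma(a_E)\,\lambda_{ES}^{a_E}\lambda_{NS}^m\gamma_0^m\left[B_{N,II}^{(2)}\right]^{a_E+n}},$$ and $$F_{Y_{\hat i},II}(x)=1-\sum_{k=0}^{a_N-1}\frac{m_N^k}{k!\lambda_{NS}^k}x^ke^{-\frac{m_Nx}{\lambda_{NS}}},\qquad F_{Z_{\hat i}}(x)=1-\sum_{k=0}^{a_E-1}\frac{m_E^k}{k!\lambda_{ES}^k}x^ke^{-\frac{m_Ex}{\lambda_{ES}}}.$$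
   Context: A source $S$ with $L_S$ antennas transmits to a near user $N$ and a far user $F$ in the presence of an eavesdropper $E$, having $L_N,L_F,L_E$ antennas. For $U\in\{N,F,E\}$, $1\le i\le L_S$, $1\le j\le L_U$, the channel power gains $|h_{U_jS_i}|^2$ (from source antenna $i$ to antenna $j$ of $U$) are mutually independent; each is gamma distributed with shape $m_U\ge 1/2$ and mean $\lambda_{US}=\Omega_U/d_{US}^{\theta_{US}}>0$ (Nakagami-$m$ fading with mean fading power $\Omega_U$, distance $d_{US}$, path-loss exponent $\theta_{US}$). The numbers $a_U=m_UL_U$ are positive integers. Put $X_i=\sum_{j=1}^{L_F}|h_{F_jS_i}|^2$, $Y_i=\sum_{j=1}^{L_N}|h_{N_jS_i}|^2$, $Z_i=\sum_{j=1}^{L_E}|h_{E_jS_i}|^2$. Power allocation coefficients: $\alpha_F>\alpha_N>0$, $\alpha_F+\alpha_N=1$. Average transmit SNRs: $\gamma_0,\gamma_E>0$. Notation: $\beta=\alpha_F/\alpha_N$ and $A_x=\frac{x}{\alpha_F-\alpha_N x}$ for $x\neq\beta$. For a transmitting antenna $i$: $$\gamma_{NS_i}^{x_F}=\frac{\alpha_F\gamma_0Y_i}{\alpha_N\gamma_0Y_i+1},\quad \gamma_{NS_i}^{x_N}=\alpha_N\gamma_0Y_i,\quad \gamma_{ES_i}^{x_F}=\frac{\alpha_F\gamma_EZ_i}{\alpha_N\gamma_EZ_i+1},\quad \gamma_{ES_i}^{x_N}=\alpha_N\gamma_EZ_i.$$ With $C_{N,i}=\log_2(1+\gamma_{NS_i}^{x_N})$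 and $C_{S,i}=\max\left\{0,\log_2\frac{1+\gamma_{NS_i}^{x_N}}{1+\gamma_{ES_i}^{x_N}}\right\}$, the secrecy outage probability of $N$ is $$SOP_{N,i}=\Pr\{\gamma_{NS_i}^{x_F}<\gamma_{th}\}+\Pr\{\gamma_{NS_i}^{x_F}\ge\gamma_{th},\gamma_{ES_i}^{x_F}<\gamma_{th},C_{N,i}<R_{s,N}\}+\Pr\{\gamma_{NS_i}^{x_F}\ge\gamma_{th},\gamma_{ES_i}^{x_F}\ge\gamma_{th},C_{S,i}<R_{s,N}\},$$ and $SOP_{N,II}$ is this quantity with $i=\hat i$. *)

(* Defs.v *)
From HB Require Import structures.
From mathcomp Require Import all_boot all_order all_algebra.
From mathcomp Require Import all_classical all_reals all_analysis.

Set Implicit Arguments.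
Unset Strict Implicit.
Unset Printing Implicit Defensive.

Import Order.TTheory GRing.Theory Num.Theory.
Import numFieldNormedType.Exports.

Local Open Scope classical_set_scope.
Local Open Scope ring_scope.

Inductive user := Near | Far | Eve.

Definition user_code (u : user) : option bool :=
  match u with Near => Some true | Far => Some false | Eve => None end.

Definition user_decode (c : option bool) : user :=
  match c with Some true => Near | Some false => Far | None => Eve end.

Lemma user_codeK : cancel user_code user_decode.
Proof. by case. Qed.

HB.instance Definition _ := Finite.copy user (can_type user_codeK).

Definition log2 (R : realType) (x : R) : R := ln x / ln 2.

Definition Gamma (R : realType) (s : R) : R :=
  \int[lebesgue_measure]_(t in `]0, +oo[) (t `^ (s - 1) * expR (- t)).

(* shape [s] and mean [l], i.e. rate [s / l] *)
Definition gamma_pdf (R : realType) (s l x : R) : R :=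
  if 0 < x then (s / l) `^ s / Gamma s * x `^ (s - 1) * expR (- (s * x / l))
  else 0.

Definition gamma_distributed d (T : measurableType d) (R : realType)
    (P : probability T R) (X : {RV P >-> R}) (s l : R) : Prop :=
  forall B : set R, measurable B ->
    distribution P X B =
    (\int[lebesgue_measure]_(x in B) (gamma_pdf s l x)%:E)%E.

Definition mutually_independent d (T : measurableType d) (R : realType)
    (P : probability T R) (I : finType) (X : I -> {RV P >-> R}) : Prop :=
  forall (J : {set I}) (B : I -> set R), (forall i, measurable (B i)) ->
    P (\bigcap_(i in [set` J]) (X i @^-1` B i)) =
    (\prod_(i in J) P (X i @^-1` B i))%E.

(* [gain u i j] is the channel power gain |h_{u_j S_i}|^2 *)
Definition total_gain d (T : measurableType d) (R : realType)
    (P : probability T R) (LS : nat) (L : user -> nat)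
    (gain : forall u : user, 'I_LS -> 'I_(L u) -> {RV P >-> R})
    (u : user) (i : 'I_LS) (w : T) : R :=
  \sum_(j < L u) gain u i j w.

(* Received SNRs when the total power gain is [x] and the average transmit
   SNR is [g]. *)
Definition snr_xF (R : realType) (alphaF alphaN g x : R) : R :=
  alphaF * g * x / (alphaN * g * x + 1).

Definition snr_xN (R : realType) (alphaN g x : R) : R := alphaN * g * x.

Definition capacity_N (R : realType) (alphaN g0 y : R) : R :=
  log2 (1 + snr_xN alphaN g0 y).

Definition secrecy_capacity_N (R : realType) (alphaN g0 gE y z : R) : R :=
  Num.max 0 (log2 ((1 + snr_xN alphaN g0 y) / (1 + snr_xN alphaN gE z))).

(* [Y i], [Z i] are the total gains of N and E from antenna [i]; the
   transmitting antenna [ihat] may be random. *)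
Definition SOP_N d (T : measurableType d) (R : realType)
    (P : probability T R) (LS : nat) (Y Z : 'I_LS -> T -> R)
    (alphaF alphaN g0 gE gth RsN : R) (ihat : T -> 'I_LS) : \bar R :=
  let NF w := snr_xF alphaF alphaN g0 (Y (ihat w) w) in
  let EF w := snr_xF alphaF alphaN gE (Z (ihat w) w) in
  let CN w := capacity_N alphaN g0 (Y (ihat w) w) in
  let CS w := secrecy_capacity_N alphaN g0 gE (Y (ihat w) w) (Z (ihat w) w) in
  let E1 := [set w | NF w < gth] in
  let E2 := [set w | [/\ gth <= NF w, EF w < gth & CN w < RsN]] in
  let E3 := [set w | [/\ gth <= NF w, gth <= EF w & CS w < RsN]] in
  (P E1 + P E2 + P E3)%E.

(* Any measurable selection of a maximizer; no tie-breaking rule is fixed. *)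
Definition is_random_argmax d (T : measurableType d) (R : realType)
    (LS : nat) (X : 'I_LS -> T -> R) (ihat : T -> 'I_LS) : Prop :=
  (forall i, measurable [set w | ihat w = i]) /\
  (forall w i, X i w <= X (ihat w) w).

Definition A_coef (R : realType) (alphaF alphaN x : R) : R :=
  x / (alphaF - alphaN * x).

(* closed form of the CDF of a gamma variable of integer shape [a] and
   rate [s / l] *)
Definition F_closed (R : realType) (a : nat) (s l x : R) : R :=
  1 - \sum_(k < a) s ^+ k / (k`!%:R * l ^+ k) * x ^+ k * expR (- (s * x / l)).

(* Main.v *)
(* The transmitting antenna depends only on the gains of F, which are independent
   of those of N and E. Since ties between the X_i are null, the event ihat = i is
   almost surely an event of the far gains, so (Y_ihat, Z_ihat) has the law of
   (Y_i, Z_i): two independent sums of i.i.d. gamma variables, again gamma, with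
   integer shapes a_N and a_E.

   Almost surely the gains are positive, and then the three outage events are
   Y < A/gamma0; A/gamma0 <= Y < gs/gamma0 with Z < A/gammaE; and
   A/gamma0 <= Y < c + e Z with Z >= A/gammaE, where c = gs/gamma0 and
   e = 2^RsN gammaE/gamma0. As c + e Z >= A/gamma0 on the last one, its probability
   is P(Y >= A/gamma0) P(Z >= A/gammaE) - P(Z >= A/gammaE, Y >= c + e Z), and the
   last term is the integral of the Erlang tail of Y at c + e z against the density
   of Z: the binomial theorem turns it into a sum of Erlang tails of rate B2. *)
Require Import Defs.
From HB Require Import structures.
From mathcomp Require Import all_boot all_order all_algebra.
From mathcomp Require Import all_classical all_reals all_analysis.
From mathcomp Require Import measurable_realfun ring lra.
Import Order.TTheory GRing.Theory Num.Theory.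
Import numFieldNormedType.Exports.
Local Open Scope classical_set_scope.
Local Open Scope ring_scope.

Set Implicit Arguments.
Unset Strict Implicit.
Unset Printing Implicit Defensive.

(** * Densities and affine substitution *)

(** Only the products m_U L_U are integers: the shape of a single gain is any real number at least
    1/2. Sums of gains are therefore handled with kernels of real shape, and Erlang formulas enter
    once the shape of a total is a natural number. The independence hypothesis speaks of product
    events of single gains, whereas the argument needs it for totals and for the event that one
    antenna is strictly best. These belong to sigma-algebras generated by disjoint groups of links,
    to which independence has to be extended. When far gains tie, the selection rule may consult the
    gains of N and E, so the chosen index is not itself a function of the far gains. Averaging over
    the index also requires one and the same law of (Y_i, Z_i) for every i, hence normalizing
    constants that are identified and not merely known to exist. *)

Section density.
Import HBNNSimple.
Local Open Scope ereal_scope.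
Context d (T : measurableType d) (R : realType).
Variables (mu nu : {measure set T -> \bar R}) (g : T -> R).
Hypotheses (mg : measurable_fun setT g) (g0 : forall x, (0 <= g x)%R).
Hypothesis nuE :
  forall A, measurable A -> nu A = \int[mu]_(x in A) (g x)%:E.

Let mEg D : measurable_fun D (EFin \o g).
Proof. exact/measurable_funTS/measurable_EFinP. Qed.

(** Both sides commute with increasing limits of simple functions and with finite sums, and on an
    indicator the identity is [nuE]. *)
Lemma ge0_integral_density (f : T -> \bar R) :
  (forall x, 0 <= f x) -> measurable_fun setT f ->
  \int[nu]_x f x = \int[mu]_x (f x * (g x)%:E).
Proof.
move=> f0 mf; pose h := nnsfun_approx measurableT mf.
have hf x : EFin \o (fun n => h n x) @ \oo --> f x by exact: cvg_nnsfun_approx.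
have -> : \int[nu]_x f x = limn (fun n => \int[nu]_x (h n x)%:E).
  rewrite -monotone_convergence//.
  - by apply: eq_integral => x _; apply/esym/cvg_lim => //; exact: hf.
  - by move=> n; exact/measurable_EFinP/measurable_funP.
  - by move=> n x _; rewrite lee_fin.
  - by move=> x _ m n mn; rewrite lee_fin; exact/lefP/nd_nnsfun_approx.
have -> : \int[mu]_x (f x * (g x)%:E) =
    limn (fun n => \int[mu]_x ((h n x)%:E * (g x)%:E)).
  rewrite -monotone_convergence//.
  - apply: eq_integral => x _; apply/esym/cvg_lim => //.
    by apply: cvgeZr => //; exact: hf.
  - move=> n; apply: emeasurable_funM => //.
    exact/measurable_EFinP/measurable_funP.
  - by move=> n x _; rewrite mule_ge0 ?lee_fin.
  - move=> x _ m n mn; rewrite lee_wpmul2r ?lee_fin//.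
    exact/lefP/nd_nnsfun_approx.
congr (limn _); apply/funext => n.
have mind r : measurable_fun setT
    (fun x => (r * \1_(h n @^-1` [set r]) x)%:E).
  by apply: (measurable_comp measurableT) => //; exact: measurable_funM.
transitivity (\int[nu]_x
   (\sum_(y \in range (h n)) (y * \1_(h n @^-1` [set y]) x)%:E)).
  by apply: eq_integral => t _; rewrite /= fimfunE -fsumEFin.
rewrite ge0_integral_fsum//; last by move=> m y _; exact: nnfun_muleindic_ge0.
transitivity (\int[mu]_x (\sum_(y \in range (h n))
    (y * \1_(h n @^-1` [set y]) x)%:E * (g x)%:E)); last first.
  apply: eq_integral => x _.
  rewrite -ge0_mule_fsuml => [|y]; last exact: nnfun_muleindic_ge0.
  by rewrite fsumEFin // -(fimfunE _ x).
rewrite ge0_integral_fsum//; last 2 first.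
  - by move=> y; apply: emeasurable_funM.
  - by move=> m y _; rewrite mule_ge0 ?lee_fin// -lee_fin nnfun_muleindic_ge0.
apply: eq_fsbigr => r rhn.
under eq_integral do rewrite EFinM.
rewrite integralZl_indic_nnsfun// integral_indic// setIT.
under [RHS]eq_integral do rewrite EFinM -muleA.
rewrite ge0_integralZl//.
- under [in RHS]eq_integral do rewrite muleC.
  rewrite [in RHS](eq_integral ((EFin \o g) \_ (h n @^-1` [set r]))); last first.
    by move=> x xE; rewrite epatch_indic.
  by rewrite -integral_mkcond nuE.
- by apply: emeasurable_funM => //; exact/measurable_EFinP.
- by move=> t _; rewrite mule_ge0 ?lee_fin ?g0.
- by move: rhn; rewrite inE => -[t _ <-]; rewrite lee_fin.
Qed.

End density.

Section affine_substitution.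
Context {R : realType}.
Variables (a b : R).
Hypothesis a0 : 0 < a.
Local Notation mu := (@lebesgue_measure R).

Let phi (x : R) : measurableTypeR R := a * x + b.

Let mphi : measurable_fun setT phi.
Proof. by apply: measurable_funD => //; exact: measurable_funM. Qed.

Let phiE (c e : R) : phi @^-1` `]c, e] = `](c - b) / a, (e - b) / a]%classic.
Proof.
apply/seteqP; split => x /=; rewrite !in_itv/= /phi.
  by rewrite ltr_pdivrMr// ler_pdivlMr// (mulrC x); lra.
by rewrite ltr_pdivrMr// ler_pdivlMr// (mulrC x); lra.
Qed.

(** The scaled pushforward is a measure giving half-open intervals their length, and this
    characterizes Lebesgue measure. *)
Lemma lebesgue_measure_affine (A : set R) : measurable A ->
  mu A = (a%:E * pushforward mu (fun x => (a * x + b)%R) A)%E.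
Proof.
pose m := mscale (NngNum (ltW a0)) (pushforward mu phi).
move=> mA; suff: mu A = m mphi A by [].
apply: lebesgue_measure_unique => // _ [[c e]] _ <-.
transitivity (a%:E * mu (phi @^-1` `]c, e]))%E; last by [].
rewrite phiE/= !lebesgue_measure_itv/= !lte_fin.
rewrite ltr_pM2r ?invr_gt0// ltrD2r.
case: ifPn => _; last by rewrite mule0.
by congr EFin; field; rewrite gt_eqF.
Qed.

Lemma ge0_integral_affine (f : R -> \bar R) :
  measurable_fun setT f -> (forall x, 0 <= f x)%E ->
  (\int[mu]_x f x = a%:E * \int[mu]_x f (a * x + b)%R)%E.
Proof.
move=> mf f0.
pose m := mscale (NngNum (ltW a0)) (pushforward mu phi).
transitivity (\int[m mphi]_x f x)%E.
  by apply: eq_measure_integral => A mA _; exact: lebesgue_measure_affine.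
rewrite ge0_integral_mscale//; congr (_ * _)%E.
by rewrite ge0_integral_pushforward.
Qed.

End affine_substitution.

(** * Gamma laws and convolution *)

(** Independence says that the law of the pair agrees with the product measure on rectangles, hence
    everywhere. The right-hand side is the product measure unfolded. *)
Lemma indep_joint_law d d1 d2 (T : measurableType d) (T1 : measurableType d1)
    (T2 : measurableType d2) (R : realType) (P : probability T R)
    (V : {RV P >-> T1}) (U : {RV P >-> T2}) (S : set (T1 * T2)) :
  (forall A B, measurable A -> measurable B ->
    P (V @^-1` A `&` U @^-1` B) = (P (V @^-1` A) * P (U @^-1` B))%E) ->
  measurable S ->
  P [set w | S (V w, U w)] =
  (\int[distribution P V]_v distribution P U (xsection S v))%E.
Proof.
move=> indep mS.
pose VU w := (V w, U w).
have mVU : measurable_fun setT VU by apply: measurable_fun_pair.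
pose VU_mixin := isMeasurableFun.Build _ _ _ _ _ mVU.
pose VU_mfun : {mfun _ >-> _} := HB.pack VU VU_mixin.
suff -> : P [set w | S (V w, U w)] =
    (distribution P V \x distribution P U)%E S by [].
apply/esym; apply: (product_measure_unique (m' := distribution P VU_mfun)) => //.
Qed.

Lemma indep_joint_density d (T : measurableType d) (R : realType)
    (P : probability T R) (V U : {RV P >-> R}) (g : R -> R) (S : set (R * R)) :
  (forall A B, measurable A -> measurable B ->
    P (V @^-1` A `&` U @^-1` B) = (P (V @^-1` A) * P (U @^-1` B))%E) ->
  measurable_fun setT g -> (forall x, 0 <= g x) ->
  (forall B, measurable B ->
    distribution P V B = \int[lebesgue_measure]_(x in B) (g x)%:E)%E ->
  measurable S ->
  P [set w | S (V w, U w)] =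
  (\int[lebesgue_measure]_v (distribution P U (xsection S v) * (g v)%:E))%E.
Proof.
move=> indep mg g0 Vg mS.
(* [lebesgue_measure] lives on [measurableTypeR R], which has the Borel sets of
   [R] but another display, so [V] is repackaged with that codomain. *)
have mV : measurable_fun setT (V : T -> measurableTypeR R).
  by move=> _ Y mY; rewrite setTI; exact: (measurable_funPTI V mY).
pose V_mixin := isMeasurableFun.Build _ _ _ _ _ mV.
pose V' : {mfun T >-> measurableTypeR R} :=
  HB.pack (V : T -> measurableTypeR R) V_mixin.
rewrite (@indep_joint_law _ _ _ _ _ _ _ P V' U)//.
rewrite (ge0_integral_density (nu := distribution P V') mg g0 Vg)//.
exact: measurable_fun_xsection.
Qed.

(** The unnormalized gamma density of shape [s] and rate [r]. Vanishing off the positive axis lets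
    convolutions run over the whole line; at rate 0 it is a pure power, from which the Beta integral
    is built. *)
Definition gker (R : realType) (s r x : R) : R :=
  if 0 < x then x `^ (s - 1) * expR (- (r * x)) else 0.

(* The normalizing constant is left free: it is determined by the total mass,
   so that sums of gamma variables need no identity between Gamma and Beta. *)
Definition gamma_law (R : realType) (s r : R) (m : set R -> \bar R) :=
  exists2 c, 0 <= c & forall B, measurable B ->
    m B = (\int[lebesgue_measure]_(x in B) (c * gker s r x)%:E)%E.

Section gamma_kernel.
Context {R : realType}.
Implicit Types s t r x : R.
Local Notation mu := (@lebesgue_measure R).

Lemma gker_ge0 s r x : 0 <= gker s r x.
Proof.
by rewrite /gker; case: ifP => // _; rewrite mulr_ge0// ?powR_ge0 ?expR_ge0.
Qed.

Lemma measurable_gker s r : measurable_fun setT (gker s r).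
Proof.
apply: measurable_fun_if => //; first exact: measurable_fun_ltr.
apply: measurable_funTS; apply: measurable_funM.
  exact: (@measurable_powR R (s - 1)).
apply: measurableT_comp => //; apply: measurableT_comp => //.
Qed.

(* The Beta integral B(s, t), possibly +oo at this stage. *)
Definition gker_conv s t : \bar R :=
  (\int[mu]_u (gker s 0 (1 - u) * gker t 0 u)%:E)%E.

Lemma gker_conv_ge0 s t : (0 <= gker_conv s t)%E.
Proof. by apply: integral_ge0 => u _; rewrite lee_fin mulr_ge0 ?gker_ge0. Qed.

Lemma gker_scale s t r x u : 0 < x ->
  x * (gker s r (x - x * u) * gker t r (x * u)) =
  gker (s + t) r x * (gker s 0 (1 - u) * gker t 0 u).
Proof.
move=> x0; have -> : x - x * u = x * (1 - u) by ring.
rewrite /gker x0 !pmulr_rgt0//.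
case: ifPn => u1; last by rewrite !(mul0r, mulr0).
case: ifPn => u0; last by rewrite !(mul0r, mulr0).
rewrite !powRM ?ltW// !mul0r oppr0 expR0 !mulr1.
have -> : x `^ (s + t - 1) = x * x `^ (s - 1) * x `^ (t - 1).
  have -> : s + t - 1 = 1 + (s - 1) + (t - 1) by ring.
  have xD (p q : R) : x `^ (p + q) = x `^ p * x `^ q.
    by rewrite powRD ?(gt_eqF x0) ?implybT.
  by rewrite (xD (1 + (s - 1))) (xD 1) powRr1 ?ltW.
have -> : - (r * x) = - (r * (x * (1 - u))) + - (r * (x * u)) by ring.
by rewrite expRD; ring.
Qed.

Lemma measurable_gker_comp s r (f : R -> R) :
  measurable_fun setT f -> measurable_fun setT (fun x => gker s r (f x)).
Proof. by move=> mf; apply: measurableT_comp => //; exact: measurable_gker. Qed.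

(** For positive [x] the substitution v = x u merges the exponentials and collects all powers of [x]
    outside the integral ([gker_scale]). For the other [x] the two factors are never both
    nonzero. *)
Lemma convolution_gker s t r x :
  (\int[mu]_v (gker s r (x - v) * gker t r v)%:E =
   (gker (s + t) r x)%:E * gker_conv s t)%E.
Proof.
have [x0|x0] := ltP 0 x; last first.
  rewrite {3}/gker ltNge x0/= mul0e integral0_eq// => v _.
  rewrite /gker; case: ifPn => xv; last by rewrite mul0r.
  by rewrite subr_gt0 in xv; rewrite ltNge (ltW (lt_le_trans xv x0)) mulr0.
rewrite (@ge0_integral_affine _ x 0 x0); last 2 first.
  - apply/measurable_EFinP; apply: measurable_funM.
      by apply: measurable_gker_comp; exact: measurable_funB.
    exact: measurable_gker.
  - by move=> v; rewrite lee_fin mulr_ge0 ?gker_ge0.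
have mf : measurable_fun setT (fun u => gker s r (x - x * u) * gker t r (x * u)).
  apply: measurable_funM; apply: measurable_gker_comp.
    by apply: measurable_funB => //; exact: measurable_funM.
  exact: measurable_funM.
rewrite -ge0_integralZl ?lee_fin ?ltW//; last 2 first.
- by under eq_fun do rewrite addr0; exact/measurable_EFinP.
- by move=> v _; rewrite lee_fin mulr_ge0 ?gker_ge0.
rewrite -ge0_integralZl ?lee_fin ?gker_ge0//; last 2 first.
- apply/measurable_EFinP; apply: measurable_funM.
    by apply: measurable_gker_comp; exact: measurable_funB.
  exact: measurable_gker.
- by move=> v _; rewrite lee_fin mulr_ge0 ?gker_ge0.
by apply: eq_integral => u _; rewrite addr0 -!EFinM gker_scale.
Qed.

End gamma_kernel.

Lemma gamma_law_add d (T : measurableType d) (R : realType)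
    (P : probability T R) (V U : {RV P >-> R}) (s t r : R) :
  (forall A B, measurable A -> measurable B ->
    P (V @^-1` A `&` U @^-1` B) = (P (V @^-1` A) * P (U @^-1` B))%E) ->
  gamma_law t r (distribution P V) -> gamma_law s r (distribution P U) ->
  gamma_law (s + t) r (fun B => P ((fun w => V w + U w) @^-1` B)).
Proof.
move=> indep [cV cV0 VE] [cU cU0 UE].
pose mu := @lebesgue_measure R.
have mgV : measurable_fun setT (fun x => cV * gker t r x).
  by apply: measurable_funM => //; exact: measurable_gker.
have mgU : measurable_fun setT (fun x => cU * gker s r x).
  by apply: measurable_funM => //; exact: measurable_gker.
have gV0 x : 0 <= cV * gker t r x by rewrite mulr_ge0 ?gker_ge0.
have gU0 x : 0 <= cU * gker s r x by rewrite mulr_ge0 ?gker_ge0.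
have mgst : measurable_fun setT (fun x => cU * cV * gker (s + t) r x).
  by apply: measurable_funM => //; exact: measurable_gker.
have gst0 x : 0 <= cU * cV * gker (s + t) r x.
  by rewrite !mulr_ge0 ?gker_ge0.
have key B : measurable B -> P ((fun w => V w + U w) @^-1` B) =
    (gker_conv s t * \int[mu]_(x in B) (cU * cV * gker (s + t) r x)%:E)%E.
  move=> mB.
  pose S := (fun p : R * R => p.1 + p.2) @^-1` B.
  have mS : measurable S.
    by rewrite -[S]setTI; apply: measurable_funD.
  rewrite (_ : _ @^-1` B = [set w | S (V w, U w)])//.
  rewrite (indep_joint_density indep mgV)//.
  (* The density of the pair at V = [p.1], V + U = [p.2], cut down to sums in [B]; exchanging the
     two integrals makes the convolution appear. *)
  pose h (p : R * R) :=
    (\1_B p.2 * (cU * gker s r (p.2 - p.1)) * (cV * gker t r p.1))%:E.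
  have mh : measurable_fun setT h.
    apply/measurable_EFinP; apply: measurable_funM.
      apply: measurable_funM.
        exact: measurableT_comp.
      apply: measurable_funM => //; apply: measurableT_comp => //.
        exact: measurable_gker.
      exact: measurable_funB.
    apply: measurable_funM => //; apply: measurableT_comp => //.
    exact: measurable_gker.
  have h0 p : (0 <= h p)%E by rewrite lee_fin !mulr_ge0 ?gker_ge0.
  transitivity (\int[mu]_v \int[mu]_x h (v, x))%E.
    apply: eq_integral => v _.
    have mf : measurable_fun setT
        (fun x => (\1_B x * (cU * gker s r (x - v)))%:E).
      apply/measurable_EFinP; apply: measurable_funM => //.
      apply: measurable_funM => //; apply: measurable_gker_comp.
      exact: measurable_funB.
    rewrite [RHS](_ : _ = \int[mu]_x ((\1_B x * (cU * gker s r (x - v)))%:E *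
      (cV * gker t r v)%:E))%E; last by apply: eq_integral.
    rewrite ge0_integralZr//; last 2 first.
      by move=> x _; rewrite lee_fin !mulr_ge0 ?gker_ge0.
      by rewrite lee_fin.
    congr (_ * _)%E.
    rewrite (_ : xsection S v = [set u | B (u + v)]); last first.
      apply/seteqP; split => u /=; rewrite xsectionE /S/= addrC//.
    rewrite UE; last first.
      by rewrite -[X in measurable X]setTI; apply: measurable_funD.
    rewrite (@ge0_integral_affine _ 1 v)//; last first.
      by move=> x; rewrite lee_fin !mulr_ge0 ?gker_ge0.
    rewrite mul1e integral_mkcond; apply: eq_integral => x _.
    rewrite epatch_indic/= mul1r addrK -EFinM mulrC; congr (_ * _)%:E.
  rewrite fubini_tonelli//.
  rewrite [in RHS]integral_mkcond -ge0_integralZl//; last 3 first.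
  - apply/(measurable_restrictT _ _).1 => //.
    exact/measurable_funTS/measurable_EFinP.
  - by move=> x _; apply: erestrict_ge0 => ? _; rewrite lee_fin.
  - exact: gker_conv_ge0.
  apply: eq_integral => x _.
  rewrite epatch_indic/=.
  transitivity ((\1_B x * (cU * cV))%:E *
      \int[mu]_v (gker s r (x - v) * gker t r v)%:E)%E.
    rewrite -ge0_integralZl//.
    - by apply: eq_integral => v _; rewrite /h/= -EFinM; congr EFin; ring.
    - apply/measurable_EFinP; apply: measurable_funM.
        by apply: measurable_gker_comp; exact: measurable_funB.
      exact: measurable_gker.
    - by move=> v _; rewrite lee_fin !mulr_ge0 ?gker_ge0.
    - by rewrite lee_fin !mulr_ge0.
  rewrite convolution_gker muleA [RHS]muleC -!EFinM; congr (_%:E * _)%E; ring.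
(* An infinite Beta integral would give total mass 0 or +oo instead of 1. *)
have b_fin : gker_conv s t \is a fin_num.
  rewrite ge0_fin_numE ?gker_conv_ge0// ltey; apply/eqP => boo.
  have := key setT measurableT; rewrite preimage_setT probability_setT boo.
  have : (0 <= \int[mu]_(x in setT) (cU * cV * gker (s + t) r x)%:E)%E.
    by apply: integral_ge0 => x _; rewrite lee_fin.
  rewrite le_eqVlt => /predU1P[<-|I0].
    by rewrite mule0 => /eqP; rewrite onee_eq0.
  by rewrite gt0_mulye.
exists (fine (gker_conv s t) * (cU * cV)).
  by rewrite !mulr_ge0// fine_ge0// gker_conv_ge0.
move=> B mB; rewrite key//.
rewrite -{1}(fineK b_fin) -ge0_integralZl//.
- by apply: eq_integral => x _; rewrite -EFinM mulrA.
- exact/measurable_funTS/measurable_EFinP.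
- by move=> x _; rewrite lee_fin.
- by rewrite lee_fin fine_ge0// gker_conv_ge0.
Qed.

(** * Integer shapes *)

(** The Poisson weight of [p] at mean [r * x]. Summed over [p < a], it is the probability of fewer
    than [a] arrivals by time [x], that is, the survival function of a gamma variable of shape [a]
    and rate [r]. *)
Definition erlang_term (R : realType) (r : R) (p : nat) (x : R) : R :=
  (r * x) ^+ p / p`!%:R * expR (- (r * x)).

Definition erlang_tail (R : realType) (a : nat) (r x : R) : R :=
  \sum_(p < a) erlang_term r p x.

Section erlang.
Context {R : realType}.
Implicit Types (r x : R) (n p : nat).
Local Notation mu := (@lebesgue_measure R).

Let fact_neq0 n : n`!%:R != 0 :> R.
Proof. by rewrite pnatr_eq0 -lt0n fact_gt0. Qed.

Let natS_neq0 n : n.+1%:R != 0 :> R.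
Proof. by rewrite pnatr_eq0. Qed.

Let is_derive_linear (a x : R) : is_derive x 1 (a \*: id : R -> R) a.
Proof.
have h := is_deriveZ a (is_derive_id x 1).
by apply: (is_derive_eq h); rewrite /GRing.scale/= mulr1.
Qed.

Lemma is_derive_erlang_term0 r x :
  is_derive x 1 (erlang_term r 0) (- r * erlang_term r 0 x).
Proof.
have d1 : is_derive x 1 (- (r \*: id) : R -> R) (- r).
  have h := is_deriveN (is_deriveZ r (is_derive_id x 1)).
  by apply: (is_derive_eq h); rewrite -[LHS]/(- (r * 1)) mulr1.
have d2 := @is_derive1_comp _ expR (- (r \*: id)) x _ _ (is_derive_expR _) d1.
have E : expR \o - (r \*: id) = erlang_term r 0.
  apply/funext => y; rewrite -[LHS]/(expR (- (r * y))) /erlang_term expr0.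
  by rewrite invr1 mulr1 mul1r.
by rewrite E in d2; apply: (is_derive_eq d2); rewrite -E mulrC.
Qed.

Lemma is_derive_erlang_termS r p x :
  is_derive x 1 (erlang_term r p.+1)
    (r * erlang_term r p x - r * erlang_term r p.+1 x).
Proof.
elim: p => [|p IH].
  have h := is_deriveM (is_derive_linear r x) (is_derive_erlang_term0 r x).
  have E : r \*: id * erlang_term r 0 = erlang_term r 1.
    apply/funext => y.
    rewrite -[LHS]/(r * y * erlang_term r 0 y) /erlang_term expr1 expr0.
    by rewrite mul1r invr1 mulr1 mul1r.
  rewrite E in h; apply: (is_derive_eq h); rewrite -E.
  rewrite -[LHS]/(r * x * (- r * erlang_term r 0 x) + erlang_term r 0 x * r).
  by rewrite -[X in _ - r * X]/(r * x * erlang_term r 0 x); ring.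
have h := is_deriveM (is_derive_linear (r / p.+2%:R) x) IH.
have fE y : erlang_term r p.+2 y = r * y / p.+2%:R * erlang_term r p.+1 y.
  rewrite /erlang_term (exprS _ p.+1) (factS p.+1) natrM.
  move: (fact_neq0 p.+1) (natS_neq0 p.+1).
  move: (p.+1`!%:R) (p.+2%:R) => a b a0 b0.
  by field; rewrite ?a0 ?b0.
have E : (r / p.+2%:R) \*: id * erlang_term r p.+1 = erlang_term r p.+2.
  apply/funext => y.
  by rewrite -[LHS]/(r / p.+2%:R * y * erlang_term r p.+1 y) fE (mulrAC r).
rewrite E in h; apply: (is_derive_eq h).
rewrite -[LHS]/(r / p.+2%:R * x *
    (r * erlang_term r p x - r * erlang_term r p.+1 x) +
  erlang_term r p.+1 x * (r / p.+2%:R)).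
rewrite fE /erlang_term (exprS _ p) factS natrM.
move: (fact_neq0 p) (natS_neq0 p) (natS_neq0 p.+1); rewrite -[p.+2%:R]natr1.
move: (p`!%:R) (p.+1%:R) => a b a0 b0 b1.
by field; rewrite ?a0 ?b0 ?b1.
Qed.

(** The derivatives of the successive Poisson weights telescope, so only the last one survives. *)
Lemma is_derive_erlang_tail r n x :
  is_derive x 1 (erlang_tail n.+1 r) (- (r * erlang_term r n x)).
Proof.
elim: n => [|n IH].
  rewrite (_ : erlang_tail 1 r = erlang_term r 0).
    by apply: is_derive_eq (is_derive_erlang_term0 r x) _; rewrite mulNr.
  by apply/funext => y; rewrite /erlang_tail big_ord1.
rewrite (_ : erlang_tail n.+2 r = erlang_tail n.+1 r + erlang_term r n.+1).
  apply: is_derive_eq (is_deriveD IH (is_derive_erlang_termS r n x)) _; ring.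
by apply/funext => y; rewrite /erlang_tail big_ord_recr.
Qed.

Lemma continuous_erlang_term r p : continuous (erlang_term r p).
Proof.
move=> x; apply/differentiable_continuous/derivable1_diffP.
case: p => [|p].
  by have := is_derive_erlang_term0 r x => -[].
by have := is_derive_erlang_termS r p x => -[].
Qed.

(** With u = r x, the bound e^u >= u^(p+1) / (p+1)! makes the term at most (p+1) / u. *)
Lemma cvgy_erlang_term r p : 0 < r -> erlang_term r p x @[x --> +oo] --> (0 : R).
Proof.
move=> r0; apply/cvgrPdist_le => e e0; near=> x.
have x0 : 0 < x by near: x; exact: nbhs_pinfty_gt.
have u0 : 0 < r * x by rewrite mulr_gt0.
rewrite sub0r normrN ger0_norm; last first.
  by rewrite mulr_ge0 ?expR_ge0// divr_ge0 ?exprn_ge0 ?ltW.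
rewrite /erlang_term expRN ler_pdivrMr ?expR_gt0// ler_pdivrMr ?ltr0n ?fact_gt0//.
have := expR_ge1Dxn p (ltW u0).
move=> /(le_trans _) -/(_ ((r * x) ^+ p.+1 / p.+1`!%:R)).
rewrite lerDr ler01 => /(_ isT) h.
have hx : p.+1%:R <= e * (r * x).
  have : p.+1%:R / (e * r) <= x by near: x; apply: nbhs_pinfty_ge; rewrite num_real.
  by rewrite ler_pdivrMr ?mulr_gt0// (mulrC x) mulrA.
apply: (@le_trans _ _ (e * ((r * x) ^+ p.+1 / p.+1`!%:R) * p`!%:R)); last first.
  by rewrite ler_wpM2r// ler_wpM2l// ltW.
rewrite factS natrM exprS invfM.
have -> : e * (r * x * (r * x) ^+ p * (p.+1%:R^-1 / p`!%:R)) * p`!%:R =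
    (e * (r * x)) / p.+1%:R * (r * x) ^+ p.
  move: (fact_neq0 p) (natS_neq0 p); move: (p`!%:R) (p.+1%:R) => a b a0 b0.
  by field; rewrite ?a0 ?b0.
apply: ler_peMl; first by rewrite exprn_ge0 ?(ltW u0).
by rewrite ler_pdivlMr ?ltr0n// mul1r.
Unshelve. all: by end_near. Qed.

Lemma cvgy_erlang_tail r n : 0 < r -> erlang_tail n r x @[x --> +oo] --> (0 : R).
Proof.
move=> r0; elim: n => [|n IH].
  rewrite (_ : erlang_tail 0 r = cst 0); first exact: cvg_cst.
  by apply/funext => y; rewrite /erlang_tail big_ord0.
rewrite (_ : erlang_tail n.+1 r = erlang_tail n r + erlang_term r n).
  by rewrite -[0]addr0; apply: cvgD => //; exact: cvgy_erlang_term.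
by apply/funext => y; rewrite /erlang_tail big_ord_recr.
Qed.

Lemma erlang_tail0 n r : erlang_tail n.+1 r 0 = 1.
Proof.
rewrite /erlang_tail big_ord_recl big1 => [|i _].
  by rewrite /erlang_term mulr0 oppr0 expR0 expr0 fact0 divr1 mulr1 addr0.
by rewrite /erlang_term mulr0 exprS !mul0r.
Qed.

Lemma erlang_term_ge0 r p x : 0 <= r -> 0 <= x -> 0 <= erlang_term r p x.
Proof.
by move=> r0 x0; rewrite mulr_ge0 ?expR_ge0// divr_ge0// exprn_ge0// mulr_ge0.
Qed.

Lemma integral_erlang_term r n x : 0 < r -> 0 <= x ->
  (\int[mu]_(t in `[x, +oo[) (r * erlang_term r n t)%:E =
   (erlang_tail n.+1 r x)%:E)%E.
Proof.
move=> r0 x0; rewrite (@ge0_continuous_FTC2y _ _ (\- erlang_tail n.+1 r) x 0).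
- by rewrite -EFinB sub0r opprK.
- by move=> t xt; rewrite mulr_ge0 ?erlang_term_ge0 ?(ltW r0) ?(le_trans x0 xt).
- apply: continuous_subspaceT => t.
  by apply: cvgM; [exact: cvg_cst|exact: continuous_erlang_term].
- by rewrite -oppr0; apply: cvgN; exact: cvgy_erlang_tail.
- by move=> t _; have := is_deriveN (is_derive_erlang_tail r n t) => -[].
- apply/cvg_at_right_filter; apply: cvgN.
  apply/differentiable_continuous/derivable1_diffP.
  by have := is_derive_erlang_tail r n x => -[].
- move=> t _; rewrite derive1E.
  by have := is_deriveN (is_derive_erlang_tail r n t) => -[_ ->]; rewrite opprK.
Qed.

Lemma gker_erlang_term n r x : 0 < r -> 0 < x ->
  gker n.+1%:R r x = n`!%:R / r ^+ n.+1 * (r * erlang_term r n x).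
Proof.
move=> r0 x0; rewrite /gker x0 /erlang_term -natr1 addrK powR_mulrn ?ltW//.
rewrite exprMn exprS; field.
by rewrite ?fact_neq0 ?expf_neq0 ?gt_eqF.
Qed.

Lemma integral_gker_itv n r x : 0 < r -> 0 <= x ->
  (\int[mu]_(t in `[x, +oo[) (gker n.+1%:R r t)%:E =
   (n`!%:R / r ^+ n.+1 * erlang_tail n.+1 r x)%:E)%E.
Proof.
move=> r0 x0.
have c0 : 0 <= n`!%:R / r ^+ n.+1 by rewrite divr_ge0// exprn_ge0// ltW.
have mT : measurable_fun setT (fun t => r * erlang_term r n t).
  apply: measurable_funM => //; apply: continuous_measurable_fun.
  exact: continuous_erlang_term.
(* The endpoint is dropped because [x] may be 0, where [gker] is 0 by convention while the Erlang
   term of index 0 is 1. *)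
rewrite -integral_itv_obnd_cbnd; last first.
  by apply/measurable_EFinP/measurable_funTS; exact: measurable_gker.
transitivity (\int[mu]_(t in `]x, +oo[)
    ((n`!%:R / r ^+ n.+1)%:E * (r * erlang_term r n t)%:E))%E.
  apply: eq_integral => t; rewrite inE/= in_itv/= andbT => xt.
  by rewrite gker_erlang_term// (le_lt_trans x0).
rewrite integral_itv_obnd_cbnd; last first.
  by apply/measurable_EFinP/measurable_funTS/measurable_funM.
rewrite ge0_integralZl//.
- by rewrite integral_erlang_term.
- exact/measurable_EFinP/measurable_funTS.
- move=> t /=; rewrite in_itv/= andbT => xt.
  by rewrite lee_fin mulr_ge0 ?erlang_term_ge0 ?(ltW r0) ?(le_trans x0 xt).
Qed.

(** Read off from the kernel integral at rate 1 over the half-line, where the Erlang tail at 0 is 1;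
    the functional equation of Gamma is not involved. *)
Lemma Gamma_natS n : Gamma (n.+1%:R : R) = n`!%:R.
Proof.
rewrite /Gamma /Rintegral.
have -> : (\int[mu]_(t in `]0%R, +oo[) (t `^ (n.+1%:R - 1) * expR (- t))%:E =
    \int[mu]_(t in `]0%R, +oo[) (gker n.+1%:R 1 t)%:E)%E.
  by apply: eq_integral => t; rewrite inE/= in_itv/= andbT /gker => ->; rewrite mul1r.
rewrite integral_itv_obnd_cbnd; last first.
  by apply/measurable_EFinP/measurable_funTS; exact: measurable_gker.
by rewrite integral_gker_itv//= erlang_tail0 expr1n divr1 mulr1.
Qed.

Section erlang_law.
Variables (n : nat) (r : R) (m : {measure set R -> \bar R}).
Hypotheses (r0 : 0 < r) (m1 : m setT = 1%E).
Hypothesis law : gamma_law n.+1%:R r m.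

Let mgker : measurable_fun setT (EFin \o gker n.+1%:R r).
Proof. by apply/measurable_EFinP; exact: measurable_gker. Qed.

Lemma gamma_law_npos : m [set x | x <= 0] = 0%E.
Proof.
have [c c0 mE] := law; rewrite mE; last by rewrite -set_itvNyc.
by apply: integral0_eq => x /= x0; rewrite /gker ltNge x0/= mulr0.
Qed.

(** The whole mass 1 sits on the nonnegative half-line, where the integral of the kernel is
    explicit; this forces the value of the free constant. *)
Lemma gamma_law_pdf B : measurable B ->
  m B = (\int[mu]_(x in B) (r ^+ n.+1 / n`!%:R * gker n.+1%:R r x)%:E)%E.
Proof.
have [c c0 mE] := law => mB; rewrite mE//; apply: eq_integral => x _.
congr (_ * _)%:E.
have : m `[(0 : R), +oo[%classic = 1%E.
  apply/eqP; rewrite eq_le -{1}m1 le_measure ?inE//=.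
  rewrite -m1 (_ : setT = [set x | x <= 0] `|` `[0, +oo[%classic); last first.
    apply/seteqP; split => // y _; rewrite /= in_itv/= andbT.
    by case: (lerP y 0) => [_|/ltW ->]; [left|right].
  apply: (le_trans (measureU2 _ _ _)) => //; first by rewrite -set_itvNyc.
  by rewrite [X in (X + _)%E](_ : _ = 0%E) ?add0e//; exact: gamma_law_npos.
rewrite mE//.
under eq_integral do rewrite EFinM.
rewrite ge0_integralZl//; last 2 first.
- exact: measurable_funTS.
- by move=> y _; rewrite lee_fin gker_ge0.
rewrite integral_gker_itv// erlang_tail0 mulr1 -EFinM => -[] c1.
have k0 : n`!%:R / r ^+ n.+1 != 0.
  by rewrite mulf_neq0 ?invr_neq0 ?expf_neq0 ?gt_eqF ?fact_neq0.
apply: (mulIf k0); rewrite c1; field.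
by rewrite ?fact_neq0 ?expf_neq0 ?gt_eqF.
Qed.

Lemma gamma_law_ge x : 0 <= x -> m `[x, +oo[%classic = (erlang_tail n.+1 r x)%:E.
Proof.
move=> x0; rewrite gamma_law_pdf//.
under eq_integral do rewrite EFinM.
rewrite ge0_integralZl//; last 3 first.
- exact: measurable_funTS.
- by move=> y _; rewrite lee_fin gker_ge0.
- by rewrite lee_fin divr_ge0 ?exprn_ge0// ltW.
rewrite integral_gker_itv// -EFinM; congr EFin; field.
by rewrite ?fact_neq0 ?expf_neq0 ?gt_eqF.
Qed.

End erlang_law.

End erlang.

(** * Independence and random selection *)

(** For fixed [A], both sides are finite measures in [B] that agree on a generating pi-system
    containing the whole space. *)
Lemma indep_g_sigma_algebra d (T : measurableType d) (R : realType)
    (P : probability T R) (G : set (set T)) (A : set T) :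
  G `<=` measurable -> setI_closed G -> G setT -> measurable A ->
  (forall B, G B -> P (B `&` A) = (P B * P A)%E) ->
  forall B, <<s G >> B -> P (B `&` A) = (P B * P A)%E.
Proof.
move=> Gm GI GT mA indep B sB.
have PA0 : 0 <= fine (P A) by rewrite fine_ge0.
have PAE : P A = (fine (P A))%:E by rewrite fineK ?fin_num_measure.
suff E : mrestr P mA B = mscale (NngNum PA0) P B.
  by rewrite -[LHS]/(mrestr P mA B) E muleC [in RHS]PAE.
apply: (g_sigma_algebra_measure_unique G Gm (fun=> setT)) sB => //.
- by apply/seteqP; split => // x _; exists 0%N.
- by move=> C GC; rewrite [LHS]indep// muleC [in LHS]PAE.
- move=> k; rewrite -[X in (X < _)%E]/(P (setT `&` A)).
  by rewrite (le_lt_trans (probability_le1 _ _)) ?ltry//; exact: measurableI.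
Qed.

Section generated_independence.
Context d (T : measurableType d) (R : realType) (P : probability T R).
Context (I : finType) (X : I -> {RV P >-> R}).
Implicit Types J K : {set I}.

(* The pi-system generating the sigma-algebra of the variables indexed by [J]. *)
Definition cylinders J : set (set T) :=
  [set E | exists2 B : I -> set R, (forall i, measurable (B i)) &
    E = \bigcap_(i in [set` J]) (X i @^-1` B i)].

Lemma cylinders_measurable J : cylinders J `<=` measurable.
Proof.
move=> _ [B mB ->].
apply: fin_bigcap_measurable; first exact: finite_finset.
by move=> i _; exact: measurable_funPTI.
Qed.

Lemma cylindersI J : setI_closed (cylinders J).
Proof.
move=> _ _ [B mB ->] [C mC ->]; exists (fun i => B i `&` C i).
  by move=> i; exact: measurableI.
by rewrite -bigcapI.
Qed.

Lemma cylindersT J : cylinders J setT.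
Proof.
exists (fun=> setT) => //; apply/esym; rewrite -subTset => w _ i _.
by rewrite preimage_setT.
Qed.

Lemma sigma_cylinders_measurable J : <<s cylinders J >> `<=` measurable.
Proof.
apply: smallest_sub; first exact: sigma_algebra_measurable.
exact: cylinders_measurable.
Qed.

Lemma sigma_cylinders_measurable_fun J i : i \in J ->
  measurable_fun setT (X i : g_sigma_algebraType (cylinders J) -> R).
Proof.
move=> iJ _ B mB; rewrite setTI; apply: sub_sigma_algebra.
exists (fun j => if j == i then B else setT); first by move=> j; case: ifP.
apply/seteqP; split => w /= h.
  by move=> j _ /=; case: eqVneq => // ->.
by have := h i iJ; rewrite /= eqxx.
Qed.

Hypothesis indep : mutually_independent X.

Lemma cylinders_indep J K (A B : set T) : (forall i, i \in J -> i \notin K) ->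
  cylinders J A -> cylinders K B -> P (A `&` B) = (P A * P B)%E.
Proof.
move=> JK [C mC ->] [D mD ->].
(* As [J] and [K] are disjoint, the two families of constraints merge into one, and the hypothesis
   applies to [J], [K] and their union with the same [E]. *)
pose E i := if i \in J then C i else D i.
have mE i : measurable (E i) by rewrite /E; case: ifP.
have EJ : \bigcap_(i in [set` J]) (X i @^-1` C i) =
    \bigcap_(i in [set` J]) (X i @^-1` E i).
  by apply: eq_bigcapr => i /= iJ; rewrite /E iJ.
have EK : \bigcap_(i in [set` K]) (X i @^-1` D i) =
    \bigcap_(i in [set` K]) (X i @^-1` E i).
  apply: eq_bigcapr => i /= iK; rewrite /E ifN//.
  by apply: contraL iK => /JK.
rewrite EJ EK -bigcap_setU (_ : [set` J] `|` [set` K] = [set` (J :|: K)%SET]).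
  rewrite !indep// -bigU/=.
    by apply: eq_bigl => i; rewrite !inE.
  by rewrite disjoint_subset; apply/fintype.subsetP => i /JK; rewrite inE.
by apply/seteqP; split => i /=; rewrite inE => /orP.
Qed.

(** The pi-system argument is used once per side: [A] is extended from cylinders with [B] fixed,
    then [B] with a cylinder fixed. *)
Lemma sigma_cylinders_indep J K (A B : set T) : (forall i, i \in J -> i \notin K) ->
  <<s cylinders J >> A -> <<s cylinders K >> B -> P (A `&` B) = (P A * P B)%E.
Proof.
move=> JK sA sB.
have mB := sigma_cylinders_measurable sB.
apply: (indep_g_sigma_algebra (@cylinders_measurable J)) sA => //.
- exact: cylindersI.
- exact: cylindersT.
move=> C JC; have mC := cylinders_measurable JC.
rewrite setIC muleC.
apply: (indep_g_sigma_algebra (@cylinders_measurable K)) sB => //.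
- exact: cylindersI.
- exact: cylindersT.
by move=> D KD; rewrite setIC muleC; exact: cylinders_indep JC KD.
Qed.

Lemma sigma_cylinders_sum J (l : seq I) : {subset l <= J} ->
  measurable_fun setT
    ((fun w => \sum_(i <- l) X i w) : g_sigma_algebraType (cylinders J) -> R).
Proof.
move=> lJ.
(* Terms outside [J] are replaced by 0 so that the summand is measurable for the small sigma-algebra
   at every index, not only at those occurring in [l]. *)
rewrite (_ : (fun w => _) =
    (fun w => \sum_(i <- l) (if i \in J then X i w else 0))); last first.
  apply/funext => w; apply: eq_big_seq => i il; by rewrite lJ.
apply: (@measurable_sum _ (g_sigma_algebraType (cylinders J)) R setT I l
  (fun i w => if i \in J then X i w else 0)) => i.
case: (boolP (i \in J)) => iJ; last exact: measurable_cst.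
exact: sigma_cylinders_measurable_fun.
Qed.

(** The list is nonempty by construction: an empty sum is the constant 0, whose law has no
    density. *)
Lemma gamma_law_sum (s r : R) i (l : seq I) :
  (forall j, j \in i :: l -> gamma_law s r (distribution P (X j))) ->
  uniq (i :: l) ->
  gamma_law ((size l).+1%:R * s) r
    (fun B => P ((fun w => \sum_(j <- i :: l) X j w) @^-1` B)).
Proof.
elim: l i => [|k l IH] i law.
  move=> _; rewrite mul1r.
  rewrite (_ : (fun w => _) = X i); last first.
    by apply/funext => w; rewrite big_seq1.
  by apply: law; rewrite mem_head.
move=> /= /andP[il kl].
have mU : measurable_fun setT (fun w => \sum_(j <- k :: l) X j w).
  by apply: measurable_sum => j; exact: measurable_funP.
pose U_mixin := isMeasurableFun.Build _ _ _ _ _ mU.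
pose U : {mfun _ >-> _} := HB.pack (fun w => \sum_(j <- k :: l) X j w) U_mixin.
have lawU : gamma_law ((size l).+1%:R * s) r (distribution P U).
  by apply: IH => // j jl; apply: law; rewrite in_cons jl orbT.
have lawX : gamma_law s r (distribution P (X i)).
  by apply: law; rewrite mem_head.
have XU A B : measurable A -> measurable B ->
    P (X i @^-1` A `&` U @^-1` B) = (P (X i @^-1` A) * P (U @^-1` B))%E.
  move=> mA mB.
  apply: (@sigma_cylinders_indep [set i]%SET [set j in k :: l]%SET).
  - by move=> j; rewrite !inE => /eqP ->; rewrite negb_or; move: il; rewrite in_cons negb_or.
  - have := @sigma_cylinders_measurable_fun [set i]%SET i (finset.set11 i) measurableT A mA.
    by rewrite setTI.
  - have klP : {subset k :: l <= [set j in k :: l]%SET} by move=> j jl; rewrite finset.inE.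
    by have := sigma_cylinders_sum klP measurableT mB; rewrite setTI.
have -> : (fun w => \sum_(j <- [:: i, k & l]) X j w) = (fun w => X i w + U w).
  by apply/funext => w; rewrite big_cons.
by rewrite -[_.+2%:R]natr1 mulrDl mul1r; exact: gamma_law_add XU lawX lawU.
Qed.

End generated_independence.

(** Once V = v is fixed, a tie confines U to a single point, which is null since U has a density. *)
Lemma indep_tie0 d (T : measurableType d) (R : realType)
    (P : probability T R) (V U : {RV P >-> R}) (s r t q : R) :
  (forall A B, measurable A -> measurable B ->
    P (V @^-1` A `&` U @^-1` B) = (P (V @^-1` A) * P (U @^-1` B))%E) ->
  gamma_law s r (distribution P V) -> gamma_law t q (distribution P U) ->
  P [set w | V w = U w] = 0%E.
Proof.
move=> indep [cV cV0 VE] [cU cU0 UE].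
pose S := [set p : R * R | p.1 = p.2].
have mS : measurable S.
  rewrite (_ : S = (fun p => p.1 - p.2) @^-1` [set 0]).
    by rewrite -[X in measurable X]setTI; apply: measurable_funB.
  by apply/seteqP; split => p; rewrite /S /=; [move=> ->; exact: subrr|exact: subr0_eq].
rewrite (_ : [set w | _] = [set w | S (V w, U w)])//.
rewrite (indep_joint_density indep _ _ VE)//.
- apply: integral0_eq => v _.
  rewrite (_ : xsection S v = [set v]); last first.
    by apply/seteqP; split => u /=; rewrite xsectionE /S/=.
  by rewrite UE// integral_set1 mul0e.
- by apply: measurable_funM => //; exact: measurable_gker.
- by move=> x; rewrite mulr_ge0 ?gker_ge0.
Qed.

(* Up to the null event of a tie, [ihat = i] is the event that the i-th variable
   is the strict maximum, which no longer depends on the selection rule. *)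
Lemma argmax_indep d (T : measurableType d) (R : realType)
    (P : probability T R) (n : nat) (X : 'I_n -> T -> R) (ihat : T -> 'I_n)
    (E : 'I_n -> set T) (q : \bar R) :
  is_random_argmax X ihat -> (forall i, measurable_fun setT (X i)) ->
  (forall i j, i != j -> P [set w | X i w = X j w] = 0%E) ->
  (forall i, measurable (E i)) ->
  (forall i, P ([set w | forall j, j != i -> X j w < X i w] `&` E i) =
     (P [set w | forall j, j != i -> (X j w < X i w)%R] * q)%E) ->
  P [set w | E (ihat w) w] = q.
Proof.
move=> [mihat ihatP] mX tie mE DE.
pose D i := [set w | forall j, j != i -> X j w < X i w].
pose N i := \big[setU/set0]_(j | j != i) [set w | X i w = X j w].
have meq i j : measurable [set w | X i w = X j w].
  rewrite (_ : [set w | _] = (fun w => X i w - X j w) @^-1` [set 0]).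
    by rewrite -[X in measurable X]setTI; apply: measurable_funB.
  by apply/seteqP; split => w /=; [move=> ->; exact: subrr|exact: subr0_eq].
have mN i : measurable (N i) by exact: bigsetU_measurable.
have N0 i : P (N i) = 0%E.
  suff [] : measurable (N i) /\ P (N i) = 0%E by [].
  apply: (big_ind (fun S => measurable S /\ P S = 0%E)).
  - by rewrite measure0.
  - move=> S S' [mS S0] [mS' S'0]; split; first exact: measurableU.
    by rewrite measureU0.
  - by move=> j ji; split => //; apply: tie; rewrite eq_sym.
have mD i : measurable (D i).
  rewrite (_ : D i = \big[setI/setT]_(j | j != i) [set w | X j w < X i w]).
    apply: bigsetI_measurable => j _.
    rewrite (_ : [set w | _] = (fun w => X j w < X i w) @^-1` [set true])//.
    by rewrite -[X in measurable X]setTI; apply: measurable_fun_ltr.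
  rewrite -bigcap_seq_cond; apply/seteqP; split => w /= h j /=.
    by move=> /andP[_]; exact: h.
  by move=> ji; apply: h; rewrite /= mem_index_enum.
have Dihat i : D i `<=` [set w | ihat w = i].
  move=> w Dw /=; apply/eqP; apply: contraT => /Dw.
  by rewrite ltNge ihatP.
have ihatD i : [set w | ihat w = i] `<=` D i `|` N i.
  move=> w /= iw; have [Dw|Dw] := pselect (D i w); [by left|right].
  move/existsNP: Dw => [j] /not_implyP[ji /negP].
  rewrite -leNgt => Xij; rewrite /N -bigcup_seq_cond; exists j.
    by rewrite /= mem_index_enum.
  by apply/eqP; rewrite eq_le Xij -iw ihatP.
(* The event [ihat = i] lies between [D i] and [D i] enlarged by the null set [N i], so the two are
   interchangeable under [P]. *)
have Pihat i B : measurable B -> P (B `&` [set w | ihat w = i]) = P (D i `&` B).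
  move=> mB; apply/eqP; rewrite eq_le; apply/andP; split; last first.
    apply: le_measure; rewrite ?inE; [exact: measurableI|exact: measurableI|].
    by move=> w [/Dihat].
  rewrite -(@measureU0 _ _ _ P (D i `&` B) (N i))//; [|exact: measurableI|exact: N0].
  apply: le_measure; rewrite ?inE; first exact: measurableI.
    by apply: measurableU => //; exact: measurableI.
  by move=> w [Bw /ihatD[Dw|Nw]]; [left|right].
have PU (F : 'I_n -> set T) : (forall i, measurable (F i)) ->
    P [set w | F (ihat w) w] = (\sum_(i < n) P (D i `&` F i))%E.
  move=> mF.
  transitivity (\sum_(i < n) P (F i `&` [set w | ihat w = i]))%E.
    rewrite -measure_bigsetU_ord//.
    - congr (P _); rewrite -bigcup_seq; apply/seteqP; split => w /=.
        by move=> Fw; exists (ihat w) => //=; rewrite mem_index_enum.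
      by move=> [k _ [Fw /= kw]]; rewrite kw.
    - by move=> i; exact: measurableI.
    - by move=> i j _ _ [w [[_ <-] [_ <-]]].
  by apply: eq_bigr => i _; exact: Pihat.
rewrite PU//; under eq_bigr do rewrite DE.
rewrite -ge0_sume_distrl//.
(* The same decomposition applied to the sure event shows that the probabilities of the [D i] add up
   to 1, which leaves [q]. *)
have := PU (fun=> setT) (fun=> measurableT).
under eq_bigr do rewrite setIT.
rewrite (_ : [set w | _] = setT) ?probability_setT => [<-|].
  by rewrite mul1e.
by apply/seteqP; split.
Qed.

(** * Two independent gamma variables of integer shape *)

(** The inverse is expressed by the real power of exponent -1, of x for positive x and of -x, with a
    sign, otherwise; at 0 both expressions are 0. *)
Lemma measurable_funV d (T : measurableType d) (R : realType) (f : T -> R) :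
  measurable_fun setT f -> measurable_fun setT (fun x => (f x)^-1).
Proof.
suff mV : measurable_fun setT (fun x : R => x^-1) by move=> mf; exact: measurableT_comp.
rewrite (_ : (fun x => _) =
    (fun x : R => if 0 < x then x `^ (- 1) else - (- x) `^ (- 1))); last first.
  apply/funext => x; case: ltP => x0; first by rewrite powR_inv1// ltW.
  by rewrite powR_inv1 ?oppr_ge0// invrN opprK.
have mp : measurable_fun setT (fun x : R => x `^ (- 1)) by exact: measurable_powR.
apply: measurable_fun_if => //; first exact: measurable_fun_ltr.
  exact: measurable_funTS.
apply: measurable_funTS.
rewrite (_ : (fun x : R => _) = (fun x => - 1 * (0 - x) `^ (- 1))); last first.
  by apply/funext => x; rewrite sub0r mulN1r.
by apply: measurable_funM => //; apply: (measurableT_comp mp); exact: measurable_funB.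
Qed.

Lemma measurable_log2 d (T : measurableType d) (R : realType) (f : T -> R) :
  measurable_fun setT f -> measurable_fun setT (fun x => log2 (f x)).
Proof.
move=> mf; apply: measurable_funM => //.
by apply: measurableT_comp => //; exact: measurable_ln.
Qed.

Lemma log2_lt (R : realType) (x r : R) : 0 < x -> (log2 x < r) = (x < 2 `^ r).
Proof.
move=> x0; have l2 : 0 < ln (2 : R) by rewrite ln_gt0// ltr1n.
by rewrite /log2 ltr_pdivrMr// -ln_powR ltr_ln// posrE// powR_gt0.
Qed.

Section two_gammas.
Context d (T : measurableType d) (R : realType) (P : probability T R).
Variables (Y Z : {RV P >-> R}) (m n : nat) (rY rZ : R).
Hypotheses (rY0 : 0 < rY) (rZ0 : 0 < rZ).
Hypothesis lawY : gamma_law m.+1%:R rY (distribution P Y).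
Hypothesis lawZ : gamma_law n.+1%:R rZ (distribution P Z).
Hypothesis indep : forall A B, measurable A -> measurable B ->
  P (Z @^-1` A `&` Y @^-1` B) = (P (Z @^-1` A) * P (Y @^-1` B))%E.
Local Notation mu := (@lebesgue_measure R).

(** The coefficient of the kernel of shape n + l + 1 and rate [rZ + rY * e] when the tail of Y at
    [c + e * z] is multiplied by the density of Z at [z]: [k] indexes the Poisson weights of the
    tail, [l] the binomial expansion of (c + e z)^k. *)
Definition joint_coef (c e : R) (k l : nat) : R :=
  rZ ^+ n.+1 / n`!%:R * (rY ^+ k / k`!%:R * expR (- (rY * c)) *
    ('C(k, l)%:R * (c ^+ (k - l) * e ^+ l))).

(* The integral over z >= z0 of the tail of Y at c + e * z against the density of
   Z, after the binomial expansion of the powers of c + e * z. *)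
Definition joint_tail (c e z0 : R) : R :=
  \sum_(k < m.+1) \sum_(l < k.+1) joint_coef c e k l *
    ((n + l)`!%:R / (rZ + rY * e) ^+ (n + l).+1 *
     erlang_tail (n + l).+1 (rZ + rY * e) z0).

Lemma erlang_tail_mul_gker c e z : 0 < z ->
  erlang_tail m.+1 rY (c + e * z) * (rZ ^+ n.+1 / n`!%:R * gker n.+1%:R rZ z) =
  \sum_(k < m.+1) \sum_(l < k.+1) joint_coef c e k l *
    gker (n + l).+1%:R (rZ + rY * e) z.
Proof.
move=> z0; rewrite /erlang_tail mulr_suml; apply: eq_bigr => k _.
rewrite /erlang_term exprMn exprDn mulr_sumr !mulr_suml.
apply: eq_bigr => l _.
rewrite /joint_coef /gker z0 -!natr1 !addrK !powR_mulrn ?ltW//.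
rewrite exprD exprMn -mulr_natl.
have -> : expR (- (rY * (c + e * z))) = expR (- (rY * c)) * expR (- (rY * e * z)).
  by rewrite -expRD; congr expR; ring.
have -> : expR (- ((rZ + rY * e) * z)) = expR (- (rZ * z)) * expR (- (rY * e * z)).
  by rewrite -expRD; congr expR; ring.
by ring.
Qed.

Lemma joint_tailE c e z0 : 0 <= c -> 0 <= e -> 0 <= z0 ->
  P [set w | z0 <= Z w /\ c + e * Z w <= Y w] = (joint_tail c e z0)%:E.
Proof.
move=> c0 e0 z00.
have B0 : 0 < rZ + rY * e by rewrite ltr_wpDr// mulr_ge0// ltW.
have K0 : 0 <= rZ ^+ n.+1 / n`!%:R by rewrite divr_ge0// exprn_ge0// ltW.
pose g z := rZ ^+ n.+1 / n`!%:R * gker n.+1%:R rZ z.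
have g0 z : 0 <= g z by rewrite mulr_ge0 ?gker_ge0.
have mg : measurable_fun setT g by apply: measurable_funM => //; exact: measurable_gker.
have Zg B : measurable B -> distribution P Z B = (\int[mu]_(z in B) (g z)%:E)%E.
  move=> mB; apply: (gamma_law_pdf rZ0 _ lawZ) => //.
  exact: probability_setT.
pose S := [set p : R * R | z0 <= p.1 /\ c + e * p.1 <= p.2].
have mS : measurable S.
  rewrite (_ : S = [set p | z0 <= p.1] `&` [set p | c + e * p.1 <= p.2])//.
  apply: measurableI.
    rewrite (_ : [set p | _] = (fun p : R * R => z0 <= p.1) @^-1` [set true])//.
    by rewrite -[X in measurable X]setTI; apply: measurable_fun_ler.
  rewrite (_ : [set p | _] = (fun p : R * R => c + e * p.1 <= p.2) @^-1` [set true])//.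
  rewrite -[X in measurable X]setTI; apply: measurable_fun_ler => //.
  by apply: measurable_funD => //; exact: measurable_funM.
rewrite (_ : [set w | _] = [set w | S (Z w, Y w)])//.
rewrite (indep_joint_density indep mg g0 Zg mS).
pose F k l z := (joint_coef c e k l * gker (n + l).+1%:R (rZ + rY * e) z)%:E.
have jc0 k l : 0 <= joint_coef c e k l.
  by rewrite !mulr_ge0 ?invr_ge0 ?exprn_ge0 ?expR_ge0// ltW.
have F0 k l z : (0 <= F k l z)%E by rewrite lee_fin mulr_ge0 ?gker_ge0.
have mF k l D : measurable_fun D (F k l).
  apply/measurable_funTS/measurable_EFinP.
  by apply: measurable_funM => //; exact: measurable_gker.
transitivity (\int[mu]_(z in `]z0, +oo[)
    \sum_(k < m.+1) \sum_(l < k.+1) F k l z)%E.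
  rewrite [RHS]integral_mkcond.
  rewrite [LHS](_ : _ = \int[mu]_z ((fun z => distribution P Y (xsection S z) * (g z)%:E)%E
     \_ `[z0, +oo[%classic) z)%E.
    (* With the endpoint removed, z > z0 >= 0 is strictly positive, as the expansion into kernels
       requires. Below [z0] the section of [S] is empty. *)
    rewrite -!integral_mkcond -integral_itv_obnd_cbnd.
      apply: eq_integral => z; rewrite inE/= in_itv/= andbT => zz0.
      rewrite (_ : xsection S z = `[c + e * z, +oo[%classic); last first.
        apply/seteqP; split => y; rewrite /= xsectionE /S/= in_itv/= andbT.
          by case.
        by split => //; exact: ltW.
      have z_gt0 : 0 < z by rewrite (le_lt_trans z00).
      rewrite (gamma_law_ge rY0 _ lawY); last 2 first.
        exact: probability_setT.
        by rewrite addr_ge0 ?mulr_ge0// ltW.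
      rewrite -EFinM erlang_tail_mul_gker// -sumEFin.
      by apply: eq_bigr => k _; rewrite -sumEFin.
    apply: emeasurable_funM; last exact/measurable_funTS/measurable_EFinP.
    by apply: measurable_funTS; exact: measurable_fun_xsection.
  apply: eq_integral => z _; rewrite patchE; case: ifPn => //.
  rewrite notin_setE/= in_itv/= andbT => /negP zz0.
  rewrite (_ : xsection S z = set0) ?measure0 ?mul0e//.
  by rewrite -subset0 => y; rewrite /= xsectionE /S/= => -[] /(elimN idP zz0).
rewrite ge0_integral_sum//; last 2 first.
- by move=> k; apply: emeasurable_sum => l; exact: mF.
- by move=> k z _; apply: sume_ge0 => l _; exact: F0.
rewrite /joint_tail -sumEFin; apply: eq_bigr => k _.
rewrite ge0_integral_sum//; last by move=> l; exact: mF.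
rewrite -sumEFin; apply: eq_bigr => l _.
rewrite integral_itv_obnd_cbnd//.
rewrite /F; under eq_integral do rewrite EFinM.
rewrite ge0_integralZl//.
- by rewrite integral_gker_itv.
- by apply/measurable_EFinP/measurable_funTS; exact: measurable_gker.
- by move=> z _; rewrite lee_fin gker_ge0.
- by rewrite lee_fin.
Qed.

Let PTY : distribution P Y setT = 1%E. Proof. exact: probability_setT. Qed.

Lemma gamma_law_prob_ge y : 0 <= y -> P [set w | y <= Y w] = (erlang_tail m.+1 rY y)%:E.
Proof.
move=> y0; rewrite -(gamma_law_ge rY0 PTY lawY y0); congr (P _).
by apply/seteqP; split => w; rewrite /= in_itv/= andbT.
Qed.

(** Clearing denominators and logarithms in the outage events is legitimate only for positive gains;
    this lemma discards the null set where a gain is not positive. *)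
Lemma eq_prob_pos (E F : set T) : measurable E -> measurable F ->
  (forall w, 0 < Y w -> 0 < Z w -> E w <-> F w) -> P E = P F.
Proof.
pose N := [set w | Y w <= 0] `|` [set w | Z w <= 0].
have mYN : measurable [set w | Y w <= 0].
  rewrite (_ : [set w | _] = Y @^-1` `]-oo, 0]%classic).
    exact: measurable_funPTI.
  by apply/seteqP; split => w; rewrite /= in_itv.
have mZN : measurable [set w | Z w <= 0].
  rewrite (_ : [set w | _] = Z @^-1` `]-oo, 0]%classic).
    exact: measurable_funPTI.
  by apply/seteqP; split => w; rewrite /= in_itv.
have mN : measurable N by exact: measurableU.
have N0 : P N = 0%E.
  rewrite measureU0//; first exact: (gamma_law_npos lawY).
  exact: (gamma_law_npos lawZ).
have le E' F' : measurable E' -> measurable F' ->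
    (forall w, 0 < Y w -> 0 < Z w -> E' w -> F' w) -> (P E' <= P F')%E.
  move=> mE mF EF; rewrite -(measureU0 mF mN N0).
  apply: le_measure; rewrite ?inE//; first exact: measurableU.
  move=> w Ew; case: (ltP 0 (Y w)) => [Y0|]; last by right; left.
  by case: (ltP 0 (Z w)) => [Z0|]; [left; exact: EF|right; right].
move=> mE mF EF; apply/eqP; rewrite eq_le !le//.
  by move=> w Y0 Z0 /(EF _ Y0 Z0).
by move=> w Y0 Z0 /(EF _ Y0 Z0).
Qed.

End two_gammas.

(** * Outage events *)

Section thresholds.
Context {R : realType}.
Implicit Types (aF aN g x y z th r : R).

(** Cross-multiplication; [aN * th < aF] keeps the coefficient of [x] positive, so the direction of
    the inequality is preserved. *)
Lemma snr_xF_lt aF aN g x th : 0 < aN -> 0 < g -> 0 < x -> aN * th < aF ->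
  (snr_xF aF aN g x < th) = (x < A_coef aF aN th / g).
Proof.
move=> aN0 g0 x0 thb; rewrite /snr_xF /A_coef.
have d0 : 0 < aN * g * x + 1 by rewrite ltr_wpDl// !mulr_ge0// ltW.
rewrite ltr_pdivrMr// ltr_pdivlMr// ltr_pdivlMr ?subr_gt0//.
by rewrite -subr_gt0 -[in RHS]subr_gt0; congr (0 < _); ring.
Qed.

(** The ratio saturates: the interfering signal grows with the gain too, so the value stays strictly
    below aF / aN. *)
Lemma snr_xF_lt_ceiling aF aN g x th : 0 < aN -> 0 < g -> 0 < x -> 0 < th ->
  aF <= aN * th -> snr_xF aF aN g x < th.
Proof.
move=> aN0 g0 x0 th0 thb; rewrite /snr_xF.
have d0 : 0 < aN * g * x + 1 by rewrite ltr_wpDl// !mulr_ge0// ltW.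
rewrite ltr_pdivrMr// mulrDr mulr1.
rewrite (le_lt_trans (y := th * (aN * g * x)))// ?ltrDl//.
have -> : th * (aN * g * x) = aN * th * g * x by ring.
by rewrite !ler_pM2r.
Qed.

Lemma capacity_N_lt aN g y r : 0 < aN -> 0 < g -> 0 < y ->
  (capacity_N aN g y < r) = (y < (2 `^ r - 1) / aN / g).
Proof.
move=> aN0 g0 y0; rewrite /capacity_N /snr_xN.
rewrite log2_lt; last by rewrite ltr_wpDr// !mulr_ge0// ltW.
rewrite !ltr_pdivlMr//.
by rewrite -subr_gt0 -[in RHS]subr_gt0; congr (0 < _); ring.
Qed.

(** As [r] is positive, truncating the capacity at 0 does not change the event. *)
Lemma secrecy_capacity_N_lt aN g gE y z r :
  0 < aN -> 0 < g -> 0 < gE -> 0 < y -> 0 < z -> 0 < r ->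
  (secrecy_capacity_N aN g gE y z < r) =
  (y < (2 `^ r - 1) / aN / g + 2 `^ r * gE / g * z).
Proof.
move=> aN0 g0 gE0 y0 z0 r0; rewrite /secrecy_capacity_N /snr_xN gt_max r0/=.
have dy : 0 < 1 + aN * g * y by rewrite ltr_wpDr// !mulr_ge0// ltW.
have dz : 0 < 1 + aN * gE * z by rewrite ltr_wpDr// !mulr_ge0// ltW.
rewrite log2_lt ?divr_gt0// ltr_pdivrMr//.
have -> : (2 `^ r - 1) / aN / g + 2 `^ r * gE / g * z =
    (2 `^ r * (1 + aN * gE * z) - 1) / (aN * g).
  by field; rewrite !gt_eqF.
rewrite ltr_pdivlMr ?mulr_gt0//.
by rewrite -subr_gt0 -[in RHS]subr_gt0; congr (0 < _); ring.
Qed.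

Lemma F_closedE a s l x : F_closed a s l x = 1 - erlang_tail a (s / l) x.
Proof.
rewrite /F_closed /erlang_tail; congr (_ - _); apply: eq_bigr => k _.
rewrite /erlang_term; congr (_ * expR _); last by congr (- _); ring.
by rewrite !exprMn exprVn invfM; ring.
Qed.

End thresholds.

Section secrecy_outage.
Context d (T : measurableType d) (R : realType) (P : probability T R).
Variables (Y Z : {RV P >-> R}) (m n : nat) (rY rZ : R).
Hypotheses (rY0 : 0 < rY) (rZ0 : 0 < rZ).
Hypothesis lawY : gamma_law m.+1%:R rY (distribution P Y).
Hypothesis lawZ : gamma_law n.+1%:R rZ (distribution P Z).
Hypothesis indep : forall A B, measurable A -> measurable B ->
  P (Z @^-1` A `&` Y @^-1` B) = (P (Z @^-1` A) * P (Y @^-1` B))%E.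
Variables (aF aN g0 gE th r : R).
Hypotheses (aN0 : 0 < aN) (g00 : 0 < g0) (gE0 : 0 < gE).
Hypotheses (th0 : 0 < th) (r0 : 0 < r).

Let mY : measurable_fun setT Y. Proof. exact: measurable_funP. Qed.
Let mZ : measurable_fun setT Z. Proof. exact: measurable_funP. Qed.

Let mlt (f g : T -> R) : measurable_fun setT f -> measurable_fun setT g ->
  measurable [set w | f w < g w].
Proof.
move=> mf mg; rewrite (_ : [set w | _] = (fun w => f w < g w) @^-1` [set true])//.
by rewrite -[X in measurable X]setTI; apply: measurable_fun_ltr.
Qed.

Let mle (f g : T -> R) : measurable_fun setT f -> measurable_fun setT g ->
  measurable [set w | f w <= g w].
Proof.
move=> mf mg; rewrite (_ : [set w | _] = (fun w => f w <= g w) @^-1` [set true])//.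
by rewrite -[X in measurable X]setTI; apply: measurable_fun_ler.
Qed.

Let msnr_xN (W : T -> R) g : measurable_fun setT W ->
  measurable_fun setT (fun w => snr_xN aN g (W w)).
Proof. by move=> mW; exact: measurable_funM. Qed.

Let msnr_xF (W : T -> R) g : measurable_fun setT W ->
  measurable_fun setT (fun w => snr_xF aF aN g (W w)).
Proof.
move=> mW; apply: measurable_funM; first exact: measurable_funM.
by apply: measurable_funV; apply: measurable_funD => //; exact: measurable_funM.
Qed.

Let mcap : measurable_fun setT (fun w => capacity_N aN g0 (Y w)).
Proof.
by apply: measurable_log2; apply: measurable_funD => //; exact: msnr_xN.
Qed.

Let msec : measurable_fun setT (fun w => secrecy_capacity_N aN g0 gE (Y w) (Z w)).
Proof.
apply: measurable_maxr => //; apply: measurable_log2; apply: measurable_funM.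
  by apply: measurable_funD => //; exact: msnr_xN.
by apply: measurable_funV; apply: measurable_funD => //; exact: msnr_xN.
Qed.

Let E1 := [set w | snr_xF aF aN g0 (Y w) < th].
Let E2 := [set w | [/\ th <= snr_xF aF aN g0 (Y w),
  snr_xF aF aN gE (Z w) < th & capacity_N aN g0 (Y w) < r]].
Let E3 := [set w | [/\ th <= snr_xF aF aN g0 (Y w),
  th <= snr_xF aF aN gE (Z w) & secrecy_capacity_N aN g0 gE (Y w) (Z w) < r]].

Let mE1 : measurable E1.
Proof. by apply: mlt => //; exact: msnr_xF. Qed.

Let mE2 : measurable E2.
Proof.
rewrite (_ : E2 = [set w | th <= snr_xF aF aN g0 (Y w)] `&`
  ([set w | snr_xF aF aN gE (Z w) < th] `&` [set w | capacity_N aN g0 (Y w) < r])).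
  apply: measurableI; first by apply: mle => //; exact: msnr_xF.
  by apply: measurableI; apply: mlt => //; exact: msnr_xF.
by apply/seteqP; split => w /= []; [|move=> ? []].
Qed.

Let mE3 : measurable E3.
Proof.
rewrite (_ : E3 = [set w | th <= snr_xF aF aN g0 (Y w)] `&`
  ([set w | th <= snr_xF aF aN gE (Z w)] `&`
   [set w | secrecy_capacity_N aN g0 gE (Y w) (Z w) < r])).
  apply: measurableI; first by apply: mle => //; exact: msnr_xF.
  apply: measurableI; first by apply: mle => //; exact: msnr_xF.
  exact: mlt.
by apply/seteqP; split => w /= []; [|move=> ? []].
Qed.

Lemma secrecy_outage_ceiling : aF <= aN * th -> (P E1 + P E2 + P E3)%E = 1%E.
Proof.
move=> thb.
rewrite (eq_prob_pos lawY lawZ mE1 measurableT); last first.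
  by move=> w Y0 Z0; split => // _; exact: snr_xF_lt_ceiling.
rewrite (eq_prob_pos lawY lawZ mE2 measurable0); last first.
  move=> w Y0 Z0; split => // -[]; rewrite leNgt => /negP + _ _; apply.
  exact: snr_xF_lt_ceiling.
rewrite (eq_prob_pos lawY lawZ mE3 measurable0); last first.
  move=> w Y0 Z0; split => // -[]; rewrite leNgt => /negP + _ _; apply.
  exact: snr_xF_lt_ceiling.
by rewrite measure0 !adde0 probability_setT.
Qed.

Let A := A_coef aF aN th.
Let c := (2 `^ r - 1) / aN / g0.
Let e := 2 `^ r * gE / g0.
Let tY := erlang_tail m.+1 rY.
Let tZ := erlang_tail n.+1 rZ.

Let two_r : 1 < (2 : R) `^ r.
Proof.
by rewrite -log2_lt// /log2 ln1 mul0r.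
Qed.

Let c0 : 0 < c.
Proof. by rewrite !divr_gt0// subr_gt0. Qed.

Let e0 : 0 < e.
Proof. by rewrite divr_gt0// mulr_gt0// (lt_trans ltr01). Qed.

Section below_ceiling.
Hypothesis thb : aN * th < aF.

Let A0 : 0 < A. Proof. by rewrite divr_gt0// subr_gt0. Qed.
Let y00 : 0 <= A / g0. Proof. by rewrite divr_ge0// ltW. Qed.
Let z00 : 0 <= A / gE. Proof. by rewrite divr_ge0// ltW. Qed.

(** The product [e * (A / gE)] is 2^r times [A / g0], and 2^r exceeds 1. This makes the event
    removed in the third outage term a subset of the quadrant where both thresholds are met. *)
Let y0_le z : A / gE <= z -> A / g0 <= c + e * z.
Proof.
move=> Az; apply: (@le_trans _ _ (0 + e * (A / gE))); last first.
  by rewrite lerD ?(ltW c0)// ler_wpM2l// ltW.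
have -> : 0 + e * (A / gE) = 2 `^ r * (A / g0).
  by rewrite /e; field; rewrite !gt_eqF.
by rewrite ler_peMl// ltW.
Qed.

Let PYge y : 0 <= y -> P [set w | y <= Y w] = (tY y)%:E.
Proof. exact: (gamma_law_prob_ge rY0 lawY). Qed.

Let PZge z : 0 <= z -> P [set w | z <= Z w] = (tZ z)%:E.
Proof. exact: (gamma_law_prob_ge rZ0 lawZ). Qed.

Let mYge y : measurable [set w | y <= Y w].
Proof. exact: mle. Qed.

Let mZge z : measurable [set w | z <= Z w].
Proof. exact: mle. Qed.

Let PZlt z : 0 <= z -> P [set w | Z w < z] = (1 - tZ z)%:E.
Proof.
move=> z0; rewrite (_ : [set w | _] = ~` [set w | z <= Z w]).
  by rewrite probability_setC// PZge.
by apply/seteqP; split => w /=; rewrite ltNge => /negP.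
Qed.

Let indepYZ (B C : set R) : measurable B -> measurable C ->
  P (Y @^-1` B `&` Z @^-1` C) = (P (Y @^-1` B) * P (Z @^-1` C))%E.
Proof. by move=> mB mC; rewrite setIC indep// muleC. Qed.

Let PE1 : P E1 = (1 - tY (A / g0))%:E.
Proof.
rewrite (eq_prob_pos (F := ~` [set w | A / g0 <= Y w]) lawY lawZ)//.
- by rewrite probability_setC// PYge.
- exact: measurableC.
- move=> w Y0 Z0; rewrite /E1/= snr_xF_lt// -/A ltNge.
  by split => /negP.
Qed.

Let PE2 : P E2 =
  (if c <= A / g0 then 0 else (tY (A / g0) - tY c) * (1 - tZ (A / gE)))%:E.
Proof.
rewrite (eq_prob_pos (F := Y @^-1` `[A / g0, c[%classic `&`
    Z @^-1` `]-oo, A / gE[%classic) lawY lawZ)//; last 2 first.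
- by apply: measurableI; exact: measurable_funPTI.
- move=> w Y0 Z0; rewrite /E2/= !in_itv/= leNgt !snr_xF_lt// -/A -leNgt.
  rewrite capacity_N_lt// -/c; split => [[-> -> ->]//|].
  by move=> [/andP[-> ->] ->].
have [cA|Ac] := leP c (A / g0).
  rewrite (_ : _ `&` _ = set0) ?measure0// -subset0 => w /= [+ _].
  by rewrite in_itv/= => /andP[/le_lt_trans h /h]; rewrite ltNge cA.
rewrite indepYZ// EFinM; congr (_ * _)%E.
  rewrite (_ : _ @^-1` _ = [set w | A / g0 <= Y w] `\` [set w | c <= Y w]).
    rewrite measureD//; last by rewrite (le_lt_trans (probability_le1 _ _)) ?ltry.
    rewrite setIidr; last by move=> w /=; apply: le_trans; exact: ltW.
    by rewrite EFinB -(PYge y00) -(PYge (ltW c0)).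
  apply/seteqP; split => w /=; rewrite in_itv/=.
    by move=> /andP[-> Yc]; split => //; apply/negP; rewrite -ltNge.
  by move=> [-> /negP]; rewrite -ltNge.
by rewrite -PZlt//; congr (P _).
Qed.

Let PE3 : P E3 =
  (tY (A / g0) * tZ (A / gE) - joint_tail m n rY rZ c e (A / gE))%:E.
Proof.
pose G := Y @^-1` `[A / g0, +oo[%classic `&` Z @^-1` `[A / gE, +oo[%classic.
pose H := [set w | A / gE <= Z w /\ c + e * Z w <= Y w].
have mG : measurable G by apply: measurableI; exact: measurable_funPTI.
have mH : measurable H.
  rewrite (_ : H = [set w | A / gE <= Z w] `&` [set w | c + e * Z w <= Y w])//.
  apply: measurableI => //; apply: mle => //.
  by apply: measurable_funD => //; exact: measurable_funM.
have HG : H `<=` G.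
  by move=> w [zZ zY]; rewrite /G/= !in_itv/= !andbT zZ (le_trans (y0_le zZ)).
rewrite (eq_prob_pos (F := G `\` H) lawY lawZ)//; last 2 first.
- exact: measurableD.
- move=> w Y0 Z0; rewrite /E3 /G /H /= !in_itv/= !andbT !leNgt !snr_xF_lt// -/A -!leNgt.
  rewrite secrecy_capacity_N_lt// -/c -/e ltNge; split => [[-> -> /negP h]|].
    by split=> // -[_].
  by move=> [[-> zZ] h]; split => //; apply/negP => ?; apply: h.
rewrite measureD//; last by rewrite (le_lt_trans (probability_le1 _ _)) ?ltry.
rewrite setIidr// [X in (_ - X)%E](joint_tailE rY0 rZ0 lawY lawZ indep (ltW c0) (ltW e0) z00).
rewrite EFinB; congr (_ - _)%E; rewrite EFinM -(PYge y00) -(PZge z00).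
rewrite [LHS]indepYZ//.
by congr (P _ * P _)%E; apply/seteqP; split => w /=; rewrite in_itv/= andbT.
Qed.

Lemma secrecy_outage_below_ceiling : (P E1 + P E2 + P E3)%E =
  ((1 - tY (A / g0)) +
   (if c <= A / g0 then 0 else (tY (A / g0) - tY c) * (1 - tZ (A / gE))) +
   (tY (A / g0) * tZ (A / gE) - joint_tail m n rY rZ c e (A / gE)))%:E.
Proof. by rewrite PE1 PE2 PE3 -!EFinD. Qed.

End below_ceiling.

End secrecy_outage.

Lemma joint_tail_closed (R : realType) (m n : nat)
    (mN mE lN lE A gs g0 gE q : R) :
  0 < mN -> 0 < mE -> 0 < lN -> 0 < lE -> 0 < g0 -> 0 < gE -> 0 < q ->
  let B2 := mE / lE + mN * gE * q / (g0 * lN) in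
  \sum_(0 <= k < m.+1) \sum_(0 <= l < k.+1) \sum_(0 <= p < n.+1 + l)
     'C(k, l)%:R *
      ((mN ^+ k * mE ^+ n.+1 * Gamma (n.+1%:R + l%:R) * gs ^+ (k - l)
        * (q * gE) ^+ l * expR (- (mN * gs / (g0 * lN))))
     / (k`!%:R * p`!%:R * Gamma n.+1%:R * lE ^+ n.+1 * lN ^+ k
        * g0 ^+ k * B2 ^+ (n.+1 + l)))
     * (A * B2 / gE) ^+ p * expR (- (A * B2 / gE)) =
  joint_tail m n (mN / lN) (mE / lE) (gs / g0) (q * gE / g0) (A / gE).
Proof.
move=> mN0 mE0 lN0 lE0 g00 gE0 q0 B2.
have B2E : mE / lE + mN / lN * (q * gE / g0) = B2.
  by rewrite /B2; field; rewrite !gt_eqF.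
have B20 : 0 < B2.
  by rewrite /B2 ltr_wpDr ?divr_gt0// ?divr_ge0 ?mulr_ge0// ltW.
rewrite /joint_tail B2E big_mkord; apply: eq_bigr => k _.
rewrite big_mkord; apply: eq_bigr => -[l /= lk] _.
rewrite big_mkord /erlang_tail !mulr_sumr; apply: eq_bigr => p _.
have -> : Gamma (n.+1%:R + l%:R : R) = (n + l)`!%:R by rewrite -natrD addSn Gamma_natS.
have -> : B2 ^+ (n.+1 + l) = B2 ^+ (n + l).+1 by [].
rewrite Gamma_natS /erlang_term /joint_coef.
have -> : B2 * (A / gE) = A * B2 / gE by ring.
have -> : mN / lN * (gs / g0) = mN * gs / (g0 * lN) by field; rewrite !gt_eqF.
rewrite !expr_div_n.
(* On the other side, [k - l] of these factors come from the powers of [gs / g0] and [l] from those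
   of [q * gE / g0]. *)
have -> : g0 ^+ k = g0 ^+ (k - l) * g0 ^+ l by rewrite -exprD subnK.
field.
rewrite !expf_neq0 ?gt_eqF// !pnatr_eq0 -!lt0n !fact_gt0//.
Qed.

(** * Channel gains *)

Lemma gamma_distributed_law d (T : measurableType d) (R : realType)
    (P : probability T R) (X : {RV P >-> R}) (s l : R) :
  gamma_distributed X s l -> gamma_law s (s / l) (distribution P X).
Proof.
move=> XE; exists ((s / l) `^ s / Gamma s).
  rewrite divr_ge0 ?powR_ge0//; apply: Rintegral_ge0 => t _.
  by rewrite mulr_ge0 ?powR_ge0 ?expR_ge0.
move=> B mB; rewrite XE//; apply: eq_integral => x _; congr EFin.
rewrite /gamma_pdf /gker; case: ifPn => _; last by rewrite mulr0.
by rewrite -mulrA (mulrAC s).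
Qed.

Section gains.
Context d (T : measurableType d) (R : realType) (P : probability T R).
Variables (LS : nat) (L : user -> nat).
Variable gain : forall u : user, 'I_LS -> 'I_(L u) -> {RV P >-> R}.
Arguments gain : clear implicits.
Let I : finType := {u : user & ('I_LS * 'I_(L u))%type}.
Let X (k : I) : {RV P >-> R} := gain (tag k) (tagged k).1 (tagged k).2.
Hypothesis indep : mutually_independent X.

Let links u i : seq I :=
  [seq Tagged (fun u => ('I_LS * 'I_(L u))%type) (i, j) | j <- enum 'I_(L u)].

Let total_gainE u i : total_gain gain u i = fun w => \sum_(k <- links u i) X k w.
Proof. by apply/funext => w; rewrite /total_gain big_map big_enum. Qed.

Let uniq_links u i : uniq (links u i).
Proof.
rewrite map_inj_uniq ?enum_uniq// => j1 j2 /eqP.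
by rewrite eq_Tagged xpair_eqE => /andP[_ /eqP].
Qed.

Definition antenna_links u i : {set I} := [set k | k \in links u i]%SET.

Lemma antenna_linksP u i k :
  k \in antenna_links u i -> tag k = u /\ (tagged k).1 = i.
Proof. by rewrite finset.inE => /mapP[j _ ->]. Qed.

Lemma antenna_links_disjoint u i u' i' : (u, i) != (u', i') ->
  forall k, k \in antenna_links u i -> k \notin antenna_links u' i'.
Proof.
move=> ui k /antenna_linksP[ku ki]; apply/negP => /antenna_linksP[ku' ki'].
by move: ui; rewrite -ku -ki -ku' -ki' eqxx.
Qed.

Lemma sigma_total_gain u i (J : {set I}) : antenna_links u i \subset J ->
  measurable_fun setT (total_gain gain u i : g_sigma_algebraType (cylinders X J) -> R).
Proof.
move=> /fintype.subsetP sJ; rewrite total_gainE; apply: sigma_cylinders_sum.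
by move=> k kl; apply: sJ; rewrite finset.inE.
Qed.

Lemma sigma_total_gain_preimage u i (J : {set I}) (B : set R) :
  antenna_links u i \subset J -> measurable B ->
  <<s cylinders X J >> (total_gain gain u i @^-1` B).
Proof.
by move=> sJ mB; have := sigma_total_gain sJ measurableT mB; rewrite setTI.
Qed.

Lemma measurable_total_gain u i : measurable_fun setT (total_gain gain u i).
Proof.
by rewrite total_gainE; apply: measurable_sum => k; exact: measurable_funP.
Qed.

Lemma total_gain_law u i (s r : R) : (0 < L u)%N ->
  (forall j, gamma_law s r (distribution P (gain u i j))) ->
  gamma_law ((L u)%:R * s) r (fun B => P (total_gain gain u i @^-1` B)).
Proof.
move=> L0 law; rewrite total_gainE.
have := uniq_links u i.
have : size (links u i) = L u by rewrite size_map size_enum_ord.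
have : forall k, k \in links u i -> gamma_law s r (distribution P (X k)).
  by move=> k /mapP[j _ ->]; exact: law.
case: (links u i) => [|k l] lawl; first by move=> /= L00; rewrite -L00 in L0.
by move=> /= <- ul; exact: gamma_law_sum.
Qed.

(** A [gamma_law] hides a constant that might vary with the antenna. Here the density is written
    without reference to [i], so a single law serves all antennas. *)
Lemma total_gain_pdf u i (n : nat) (r : R) (B : set R) : 0 < r ->
  gamma_law n.+1%:R r (fun B => P (total_gain gain u i @^-1` B)) ->
  measurable B ->
  P (total_gain gain u i @^-1` B) =
  (\int[lebesgue_measure]_(x in B) (r ^+ n.+1 / n`!%:R * gker n.+1%:R r x)%:E)%E.
Proof.
move=> r0 law mB.
pose V_mixin := isMeasurableFun.Build _ _ _ _ _ (@measurable_total_gain u i).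
pose V : {mfun T >-> R} := HB.pack (total_gain gain u i) V_mixin.
apply: (@gamma_law_pdf _ n r (distribution P V)) => //.
exact: probability_setT.
Qed.

Lemma total_gain_indep u i u' i' (B C : set R) : (u, i) != (u', i') ->
  measurable B -> measurable C ->
  P (total_gain gain u i @^-1` B `&` total_gain gain u' i' @^-1` C) =
  (P (total_gain gain u i @^-1` B) * P (total_gain gain u' i' @^-1` C))%E.
Proof.
move=> ui mB mC.
apply: (sigma_cylinders_indep indep (antenna_links_disjoint ui)).
- exact: sigma_total_gain_preimage.
- exact: sigma_total_gain_preimage.
Qed.

Lemma total_gain_tie0 u i j (s r : R) : i != j ->
  gamma_law s r (fun B => P (total_gain gain u i @^-1` B)) ->
  gamma_law s r (fun B => P (total_gain gain u j @^-1` B)) ->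
  P [set w | total_gain gain u i w = total_gain gain u j w] = 0%E.
Proof.
move=> ij lawi lawj.
pose Vi_mixin := isMeasurableFun.Build _ _ _ _ _ (@measurable_total_gain u i).
pose Vi : {mfun T >-> R} := HB.pack (total_gain gain u i) Vi_mixin.
pose Vj_mixin := isMeasurableFun.Build _ _ _ _ _ (@measurable_total_gain u j).
pose Vj : {mfun T >-> R} := HB.pack (total_gain gain u j) Vj_mixin.
apply: (@indep_tie0 _ _ _ P Vi Vj s r s r) => // B C mB mC.
by apply: total_gain_indep => //; rewrite xpair_eqE eqxx.
Qed.

Definition user_links u : {set I} := [set k | tag k == u]%SET.

Lemma antenna_links_user u i (J : {set I}) : user_links u \subset J ->
  antenna_links u i \subset J.
Proof.
move=> /fintype.subsetP uJ; apply/fintype.subsetP => k /antenna_linksP[ku _].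
by apply: uJ; rewrite finset.inE ku.
Qed.

(** The event that an antenna is strictly best for [u] is generated by the links of [u], and the
    events on [v] and [w] by all other links, so they are independent. The laws [muV] and [muW]
    common to all antennas make the product the same for each value of [ihat]. *)
Lemma argmax_total_gain_joint (u v w : user) (ihat : T -> 'I_LS)
    (muV muW : set R -> \bar R) (s r : R) (B C : set R) :
  u != v -> u != w -> v != w ->
  is_random_argmax (total_gain gain u) ihat ->
  (forall i, gamma_law s r (fun B => P (total_gain gain u i @^-1` B))) ->
  (forall i B, measurable B -> P (total_gain gain v i @^-1` B) = muV B) ->
  (forall i B, measurable B -> P (total_gain gain w i @^-1` B) = muW B) ->
  measurable B -> measurable C ->
  P [set x | B (total_gain gain v (ihat x) x) /\ C (total_gain gain w (ihat x) x)] =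
  (muV B * muW C)%E.
Proof.
move=> uv uw vw ihatP lawU lawV lawW mB mC.
have mpre t i D : measurable D -> measurable (total_gain gain t i @^-1` D).
  by move=> mD; rewrite -[X in measurable X]setTI; exact: measurable_total_gain.
apply: (argmax_indep (E := fun i => total_gain gain v i @^-1` B `&`
  total_gain gain w i @^-1` C) ihatP) => //.
- by move=> i; exact: measurable_total_gain.
- by move=> i j ij; exact: total_gain_tie0 (lawU i) (lawU j).
- by move=> i; apply: measurableI; exact: mpre.
move=> i.
have vw_i : P (total_gain gain v i @^-1` B `&` total_gain gain w i @^-1` C) =
    (muV B * muW C)%E.
  by rewrite total_gain_indep ?lawV ?lawW// xpair_eqE (negbTE vw).
rewrite -[in RHS]vw_i.
apply: (sigma_cylinders_indep indep (J := user_links u)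
    (K := [set k | tag k != u]%SET)).
- by move=> k; rewrite !finset.inE => ->.
- rewrite (_ : [set x | _] = \big[setI/setT]_(j | j != i)
      [set x | total_gain gain u j x < total_gain gain u i x]); last first.
    rewrite -bigcap_seq_cond; apply/seteqP; split => x /= h j /=.
      by move=> /andP[_]; exact: h.
    by move=> ji; apply: h; rewrite /= mem_index_enum.
  apply: (@bigsetI_measurable _ (g_sigma_algebraType (cylinders X (user_links u)))).
  move=> j _.
  have := @measurable_fun_ltr _ (g_sigma_algebraType (cylinders X (user_links u)))
    R setT _ _ (sigma_total_gain (antenna_links_user j (subxx _)))
    (sigma_total_gain (antenna_links_user i (subxx _))) measurableT [set true].
  by rewrite setTI; exact.
- have sub t : t != u -> user_links t \subset [set k | tag k != u]%SET.
    move=> tu; apply/fintype.subsetP => k; rewrite !finset.inE => /eqP ->//.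
  apply: (@measurableI _ (g_sigma_algebraType
    (cylinders X [set k | tag k != u]%SET))).
    apply: sigma_total_gain_preimage => //.
    by apply: antenna_links_user; apply: sub; rewrite eq_sym.
  apply: sigma_total_gain_preimage => //.
  by apply: antenna_links_user; apply: sub; rewrite eq_sym.
Qed.

Lemma measurable_total_gain_selected u (ihat : T -> 'I_LS) :
  (forall i, measurable [set x | ihat x = i]) ->
  measurable_fun setT (fun x => total_gain gain u (ihat x) x).
Proof.
move=> mihat _ B mB; rewrite setTI.
rewrite (_ : _ @^-1` B = \big[setU/set0]_(i < LS)
    (total_gain gain u i @^-1` B `&` [set x | ihat x = i])).
  apply: bigsetU_measurable => i _; apply: measurableI => //.
  by rewrite -[X in measurable X]setTI; exact: measurable_total_gain.
rewrite -bigcup_seq; apply/seteqP; split => x /=.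
  by move=> Bx; exists (ihat x) => //=; rewrite mem_index_enum.
by move=> [i _ [Bx /= xi]]; rewrite xi.
Qed.

End gains.

Unset Implicit Arguments.

Theorem theorem4 (R : realType) (d : measure_display) (T : measurableType d)
  (P : probability T R)
  (LS : nat) (L a : user -> nat) (shape Omega dist theta lambda : user -> R)
  (gain : forall u : user, 'I_LS -> 'I_(L u) -> {RV P >-> R})
  (alphaF alphaN gamma0 gammaE RF RsN : R) (ihat : T -> 'I_LS)
  (shape_ge : forall u, 2^-1 <= shape u)
  (Omega_gt0 : forall u, 0 < Omega u)
  (dist_gt0 : forall u, 0 < dist u)
  (lambdaE : forall u, lambda u = Omega u / dist u `^ theta u)
  (a_gt0 : forall u, (0 < a u)%N)
  (aE : forall u, (a u)%:R = shape u * (L u)%:R)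
  (gain_gamma : forall u i j,
     gamma_distributed (gain u i j) (shape u) (lambda u))
  (gain_indep : mutually_independent
     (fun k : {u : user & ('I_LS * 'I_(L u))%type} =>
        gain (tag k) (tagged k).1 (tagged k).2))
  (alphaN_gt0 : 0 < alphaN) (alphaF_gt : alphaN < alphaF)
  (alpha_sum : alphaF + alphaN = 1)
  (gamma0_gt0 : 0 < gamma0) (gammaE_gt0 : 0 < gammaE)
  (RF_gt0 : 0 < RF) (RsN_gt0 : 0 < RsN)
  (ihat_argmax : is_random_argmax (total_gain gain Far) ihat) :
  let beta := alphaF / alphaN in
  let gth := 2 `^ RF - 1 in
  let gs := (2 `^ RsN - 1) / alphaN in
  let eta := log2 (alphaF / (alphaF - alphaN * gth)) in
  let A := A_coef alphaF alphaN gth in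
  let mN := shape Near in
  let mE := shape Eve in
  let lN := lambda Near in
  let lE := lambda Eve in
  let FY := F_closed (a Near) mN lN in
  let FZ := F_closed (a Eve) mE lE in
  let Lambda1 := FY (A / gamma0) in
  let Lambda2 :=
    if RsN < eta then 0
    else (FY (gs / gamma0) - FY (A / gamma0)) * FZ (A / gammaE) in
  let B1 := (1 - FY (A / gamma0)) * (1 - FZ (A / gammaE)) in
  let B2 := mE / lE + mN * gammaE * 2 `^ RsN / (gamma0 * lN) in
  let Psi (m n p : nat) :=
    'C(m, n)%:R *
    ((mN ^+ m * mE ^+ a Eve * Gamma ((a Eve)%:R + n%:R) * gs ^+ (m - n)
        * (2 `^ RsN * gammaE) ^+ n * expR (- (mN * gs / (gamma0 * lN))))
     / (m`!%:R * p`!%:R * Gamma (a Eve)%:R * lE ^+ a Eve * lN ^+ m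
        * gamma0 ^+ m * B2 ^+ (a Eve + n))) in
  let Lambda3 :=
    B1 - \sum_(0 <= m < a Near) \sum_(0 <= n < m.+1)
           \sum_(0 <= p < a Eve + n)
             Psi m n p * (A * B2 / gammaE) ^+ p * expR (- (A * B2 / gammaE)) in
  (gth < beta -> RsN != eta) ->
  SOP_N P (total_gain gain Near) (total_gain gain Eve)
    alphaF alphaN gamma0 gammaE gth RsN ihat
  = (if gth < beta then Lambda1 + Lambda2 + Lambda3 else 1)%:E.
Proof.
move=> beta gth gs eta A mN mE lN lE FY FZ Lambda1 Lambda2 B1 B2 Psi Lambda3 RsNeta.
have L0 u : (0 < L u)%N.
  rewrite lt0n; apply/negP => /eqP Lu; have := aE u.
  by rewrite Lu mulr0 => /eqP; rewrite pnatr_eq0 eqn0Ngt a_gt0.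
have s0 u : 0 < shape u by rewrite (lt_le_trans _ (shape_ge u)).
have l0 u : 0 < lambda u by rewrite lambdaE divr_gt0// powR_gt0.
have rate0 u : 0 < shape u / lambda u by rewrite divr_gt0.
have law u i : gamma_law (a u)%:R (shape u / lambda u)
    (fun B => P (total_gain gain u i @^-1` B)).
  rewrite aE mulrC; apply: total_gain_law => // j.
  exact: gamma_distributed_law.
(* From here on [n] belongs to Near and [m] to Eve, opposite to section [two_gammas], where [m] goes
   with [Y] and [n] with [Z]. *)
have [n nE] : exists n, a Near = n.+1 by exists (a Near).-1; rewrite prednK.
have [m mE'] : exists m, a Eve = m.+1 by exists (a Eve).-1; rewrite prednK.
have lawN i : gamma_law n.+1%:R (mN / lN)
    (fun B => P (total_gain gain Near i @^-1` B)) by rewrite -nE; exact: law.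
have lawE i : gamma_law m.+1%:R (mE / lE)
    (fun B => P (total_gain gain Eve i @^-1` B)) by rewrite -mE'; exact: law.
have [mihat _] := ihat_argmax.
pose Y_mixin := isMeasurableFun.Build _ _ _ _ _
  (@measurable_total_gain_selected _ _ _ P LS L gain Near ihat mihat).
pose Y : {mfun T >-> R} :=
  HB.pack (fun w => total_gain gain Near (ihat w) w) Y_mixin.
pose Z_mixin := isMeasurableFun.Build _ _ _ _ _
  (@measurable_total_gain_selected _ _ _ P LS L gain Eve ihat mihat).
pose Z : {mfun T >-> R} :=
  HB.pack (fun w => total_gain gain Eve (ihat w) w) Z_mixin.
pose pdf k r x := r ^+ k.+1 / k`!%:R * gker k.+1%:R r x : R.
pose mu k r (B : set R) : \bar R := (\int[lebesgue_measure]_(x in B) (pdf k r x)%:E)%E.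
have joint B C : measurable B -> measurable C ->
    P (Z @^-1` B `&` Y @^-1` C) = (mu m (mE / lE)%R B * mu n (mN / lN)%R C)%E.
  apply: (argmax_total_gain_joint gain_indep _ _ _ ihat_argmax (law Far)) => //.
    by move=> i D mD; exact: (total_gain_pdf (rate0 Eve) (lawE i) mD).
  by move=> i D mD; exact: (total_gain_pdf (rate0 Near) (lawN i) mD).
(* A sample point exists since P has mass 1; its image [ihat w] is an antenna whose total gains show
   that both densities have mass 1. *)
have [w _] : exists w : T, True.
  apply: contrapT => noT; have := probability_setT P.
  rewrite (_ : setT = set0) ?measure0; last first.
    by rewrite -subset0 => w _; apply: noT; exists w.
  by move/esym/eqP; rewrite onee_eq0.
have muN1 : mu n (mN / lN) setT = 1%E.
  rewrite /mu -(total_gain_pdf (rate0 Near) (lawN (ihat w)))// preimage_setT.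
  exact: probability_setT.
have muE1 : mu m (mE / lE) setT = 1%E.
  rewrite /mu -(total_gain_pdf (rate0 Eve) (lawE (ihat w)))// preimage_setT.
  exact: probability_setT.
(* Each marginal comes from the joint formula with the other set taken to be the whole line;
   independence of [Y] and [Z] then follows. *)
have YE B : measurable B -> P (Y @^-1` B) = mu n (mN / lN) B.
  by move=> mB; have := joint setT B measurableT mB; rewrite preimage_setT setTI muE1 mul1e.
have ZE B : measurable B -> P (Z @^-1` B) = mu m (mE / lE) B.
  by move=> mB; have := joint B setT mB measurableT; rewrite preimage_setT setIT muN1 mule1.
have c0 k r : 0 < r -> 0 <= r ^+ k.+1 / k`!%:R :> R.
  by move=> r0; rewrite divr_ge0// exprn_ge0// ltW.
have lawY : gamma_law n.+1%:R (mN / lN) (distribution P Y).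
  by exists ((mN / lN) ^+ n.+1 / n`!%:R); [exact: c0 (rate0 Near)|exact: YE].
have lawZ : gamma_law m.+1%:R (mE / lE) (distribution P Z).
  by exists ((mE / lE) ^+ m.+1 / m`!%:R); [exact: c0 (rate0 Eve)|exact: ZE].
have indep B C : measurable B -> measurable C ->
    P (Z @^-1` B `&` Y @^-1` C) = (P (Z @^-1` B) * P (Y @^-1` C))%E.
  by move=> mB mC; rewrite joint// ZE// YE.
have gth0 : 0 < gth by rewrite subr_gt0 -log2_lt// /log2 ln1 mul0r.
have [thb|thb] := ltP gth beta; last first.
  apply: (secrecy_outage_ceiling lawY lawZ gammaE RsN alphaN_gt0) => //.
  by move: thb; rewrite /beta ler_pdivrMr// mulrC.
have thb' : alphaN * gth < alphaF by move: (thb); rewrite /beta ltr_pdivlMr// mulrC.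
transitivity ((1 - erlang_tail n.+1 (mN / lN) (A / gamma0) +
   (if gs / gamma0 <= A / gamma0 then 0 else
     (erlang_tail n.+1 (mN / lN) (A / gamma0) -
      erlang_tail n.+1 (mN / lN) (gs / gamma0)) *
     (1 - erlang_tail m.+1 (mE / lE) (A / gammaE))) +
   (erlang_tail n.+1 (mN / lN) (A / gamma0) *
    erlang_tail m.+1 (mE / lE) (A / gammaE) -
    joint_tail n m (mN / lN) (mE / lE) (gs / gamma0) (2 `^ RsN * gammaE / gamma0)
      (A / gammaE)))%:E).
  exact: (secrecy_outage_below_ceiling (rate0 Near) (rate0 Eve) lawY lawZ indep
    alphaN_gt0 gamma0_gt0 gammaE_gt0 gth0 RsN_gt0 thb').
congr EFin.
(* Comparing [gs] with [A] amounts to comparing 2^RsN with alphaF / (alphaF - alphaN gth) = 2^eta in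
   the weak sense; [RsN != eta] makes the weak and strict inequalities coincide. *)
have condE : (gs / gamma0 <= A / gamma0) = (RsN < eta).
  have d0 : 0 < alphaF - alphaN * gth by rewrite subr_gt0.
  have q0 : 0 < alphaF / (alphaF - alphaN * gth).
    by rewrite divr_gt0// (lt_trans alphaN_gt0).
  have -> : (RsN < eta) = ~~ (eta < RsN).
    by rewrite -leNgt [RHS]le_eqVlt (negbTE (RsNeta thb)).
  rewrite log2_lt// -leNgt.
  rewrite ler_pM2r ?invr_gt0// /gs /A /A_coef ler_pdivrMr//.
  rewrite -subr_ge0 -[in RHS]subr_ge0; congr (0 <= _).
  by field; rewrite gt_eqF.
rewrite /Lambda1 /Lambda2 /Lambda3 /B1 /FY /FZ !F_closedE -condE nE mE'.
congr (_ + _ + _).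
  by case: ifP => // _; congr (_ * _); ring.
congr (_ - _); first by ring.
have q0 : 0 < (2 : R) `^ RsN by rewrite powR_gt0.
rewrite /Psi mE'; apply/esym.
exact: (joint_tail_closed n m A gs (s0 Near) (s0 Eve) (l0 Near) (l0 Eve)
  gamma0_gt0 gammaE_gt0 q0).
Qed.
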